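(* Let $p$ be a prime, $n\ge1$, $h\in\mathbb{Z}_p$, $\boldsymbol a=(a_1,\dots,a_n)\in\mathbb{Z}_p^n$, and $q=1+t\in\Omega$ with $0<|t|_p<1$. If $a_1,\dots,a_n$ are pairwise distinct, then the constant term $\mathsf U(h,\boldsymbol a,q,0)$ of the Frobenius intertwiner $\mathsf U(h,\boldsymbol a,q,z)$ (defined in the context) is diagonal in the basis of torus fixed points of $K_T(X)$, $X=T^*\mathbb{P}^{n-1}$, with eigenvalues $$\mathsf U(h,\boldsymbol a,q,0)_{i,i}=\prod_{j=1}^n\frac{\Gamma_{p,q}(p(a_i-a_j+h))}{\Gamma_{p,q}(p(a_i-a_j))\,\Gamma_{p,q}(ph)},\qquad i=1,\dots,n.$$
   Context: $\Omega$ is the completion of an algebraic closure of $\mathbb{Q}_p$. For $q=1+t$, $|t|_p<1$ and $b\in\mathbb{Z}_p$, $q^b=\sum_k\binom bk t^k$. Put $(y;q)_d=(1-y)(1-yq)\cdots(1-yq^{d-1})$, $(y;q)_\infty=\prod_{m\ge0}(1-yq^m)$, $[i]_q=(1-q^i)/(1-q)$. $\Gamma_{p,q}$ is Koblitz's $p$-adic $q$-gamma function: the continuous extension to $\mathbb{Z}_p$ of $\Gamma_{p,q}(m)=(-1)^m\prod_{0<i<m,\ p\nmid i}[i]_q$, $m\in\mathbb{N}$. For $1\le j\le n$ let $$f_j(h,\boldsymbol a,q,z)=\sum_{d\ge0}\Big(\prod_{k=1}^n\frac{(q^{a_j-a_k+h};q)_d}{(q^{a_j-a_k+1};q)_d}\Big)z^d,\qquad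 \Psi'(h,\boldsymbol a,q,z)_{i,j}=q^{(i-1)a_j}f_j(h,\boldsymbol a,q,zq^{i-1}),$$ $$\Phi(h,\boldsymbol a,x,q,z)=\Big(\frac{(q^h;q)_\infty}{(q;q)_\infty}\Big)^n\prod_{i=1}^n\frac{(q^{x+1-a_i};q)_\infty}{(q^{x+h-a_i};q)_\infty}\,z^x ,$$ $\tilde\Psi(h,\boldsymbol a,q,z)=\Psi'(h,\boldsymbol a,q,z)\,\mathrm{diag}_j(\Phi(h,\boldsymbol a,a_j,q,z))$, and $$\mathsf U(h,\boldsymbol a,q,z)=\tilde\Psi(ph,p\boldsymbol a,q,z)\tilde\Psi(h,\boldsymbol a,q^p,z^p)^{-1}=\Psi'(ph,p\boldsymbol a,q,z)\,\mathrm{diag}_j\Big(\tfrac{\Phi(ph,p\boldsymbol a,pa_j,q,z)}{\Phi(h,\boldsymbol a,a_j,q^p,z^p)}\Big)\Psi'(h,\boldsymbol a,q^p,z^p)^{-1}.$$ In the middle ratio the powers of $z$ cancel, and the ratio is a product over $k$ of factors $$\Big[\tfrac{(q^{ph};q)_\infty (q^{pm+1};q)_\infty}{(q;q)_\infty (q^{pm+ph};q)_\infty}\Big]\Big/\Big[\tfrac{(q^{ph};q^p)_\infty (q^{pm+p};q^p)_\infty}{(q^p;q^p)_\infty (q^{pm+ph};q^p)_\infty}\Big],\quad m=a_j-a_k;$$ for $m,h\in\mathbb{N}$ this is a finite expression after formal cancellation, and for $m,h\in\mathbb{Z}_p$ it is understood by $p$-adic continuity. At parameter values where denominators vanish or $\Psi'$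 is not invertible, the coefficients of powers of $z$ in $\mathsf U$ are understood as limits from generic values. The basis of torus fixed points is represented (when the $q^{pa_i}$ are distinct) by the column vectors $v_i=(1,q^{pa_i},\dots,q^{(n-1)pa_i})^T$, $i=1,\dots,n$, i.e. the columns of $\Psi'(ph,p\boldsymbol a,q,0)=\Psi'(h,\boldsymbol a,q^p,0)$; ''diagonal with eigenvalues $\mathsf U_{i,i}$'' means $\mathsf U(h,\boldsymbol a,q,0)v_i=\mathsf U_{i,i}v_i$. *)

(* Defs.v *)
From HB Require Import structures.
From mathcomp Require Import all_boot all_order all_algebra zify.
From mathcomp Require Import boolp classical_sets reals.

Set Implicit Arguments.
Unset Strict Implicit.
Unset Printing Implicit Defensive.

Import Order.TTheory GRing.Theory Num.Theory.
Local Open Scope ring_scope.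

Section ValuedField.
Variables (R : realType) (K : fieldType) (abs : K -> R).

Definition closure_pt (S : K -> Prop) (x : K) : Prop :=
  forall e : R, 0 < e -> exists2 y, S y & abs (x - y) < e.

Definition cvg_seq_to (u : nat -> K) (l : K) : Prop :=
  forall e : R, 0 < e -> exists N : nat, forall k : nat,
    (N <= k)%N -> abs (u k - l) < e.

Definition cauchy_seq (u : nat -> K) : Prop :=
  forall e : R, 0 < e -> exists N : nat, forall k l : nat,
    (N <= k)%N -> (N <= l)%N -> abs (u k - u l) < e.

(* When K is complete of characteristic 0 and abs extends the p-adic absolute
   value, these closures are the copies of Q_p and Z_p inside K. *)
Definition Qp_in (x : K) : Prop := closure_pt (fun y => exists r : rat, y = ratr r) x.
Definition Zp_in (x : K) : Prop := closure_pt (fun y => exists m : int, y = m%:~R) x.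

Definition poly_over_Qp (P : {poly K}) : Prop := forall i : nat, Qp_in P`_i.

Definition alg_over_Qp (x : K) : Prop :=
  exists P : {poly K}, [/\ P != 0, poly_over_Qp P & root P x].

End ValuedField.

(* A complete ultrametric field extending (Q, |.|_p) in which the elements
   algebraic over Q_p form an algebraic closure of Q_p (every nonconstant
   polynomial over Q_p has a root) and are dense.  Any two such fields are
   isometrically isomorphic. *)
Record completedAlgClosureQp (R : realType) (p : nat) := CompletedAlgClosureQp {
  Omega_field :> fieldType;
  pabs : Omega_field -> R;
  pabs_ge0 : forall x, 0 <= pabs x;
  pabs_eq0 : forall x, pabs x = 0 <-> x = 0;
  pabsM : forall x y, pabs (x * y) = pabs x * pabs y;
  pabsD : forall x y, pabs (x + y) <= Num.max (pabs x) (pabs y);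
  pabs_p : pabs p%:R = p%:R^-1;
  pabs_complete : forall u, cauchy_seq pabs u -> exists l, cvg_seq_to pabs u l;
  Qp_alg_closed : forall P : {poly Omega_field},
    (1 < size P)%N -> poly_over_Qp pabs P -> exists x, root P x;
  Qp_alg_dense : forall x, closure_pt pabs (alg_over_Qp pabs) x
}.

Section MatrixPowerSeries.
Variables (K : fieldType) (n : nat).

(* A k is the coefficient of z^k *)
Definition mps := nat -> 'M[K]_n.

Definition mps_mul (A B : mps) : mps :=
  fun k => \sum_(i < k.+1) A i *m B (k - i)%N.

Definition mps_const (M : 'M[K]_n) : mps := fun k => if k == 0%N then M else 0.

(* A(z^r) *)
Definition mps_subst_pow (r : nat) (A : mps) : mps :=
  fun k => if (r %| k)%N then A (k %/ r)%N else 0.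

(* The first k+1 coefficients of the inverse series B of A, from
   B_0 = A_0^-1 and B_k = - A_0^-1 (A_k B_0 + ... + A_1 B_(k-1)). *)
Fixpoint mps_inv_seq (A : mps) (k : nat) : seq 'M[K]_n :=
  if k is k'.+1 then
    let s := mps_inv_seq A k' in
    rcons s (- (invmx (A 0%N) *m \sum_(i < k) A (k - i)%N *m s`_i))
  else [:: invmx (A 0%N)].

Definition mps_inv (A : mps) : mps := fun k => (mps_inv_seq A k)`_k.

Lemma size_mps_inv_seq A k : size (mps_inv_seq A k) = k.+1.
Proof. by elim: k => //= k IH; rewrite size_rcons IH. Qed.

Lemma nth_mps_inv_seq A k i : (i <= k)%N -> (mps_inv_seq A k)`_i = mps_inv A i.
Proof.
elim: k => [|k IH]; first by rewrite leqn0 => /eqP ->.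
rewrite leq_eqVlt => /orP[/eqP -> //|lt_ik].
by rewrite /= nth_rcons size_mps_inv_seq lt_ik IH.
Qed.

Lemma mps_mulV A : A 0%N \in unitmx -> mps_mul A (mps_inv A) =1 mps_const 1%:M.
Proof.
move=> uA [|k]; rewrite /mps_mul /mps_const.
  by rewrite big_ord_recl big_ord0 addr0 /mps_inv /= mulmxV.
rewrite big_ord_recl /= subn0 {1}/mps_inv /= nth_rcons size_mps_inv_seq ltnn eqxx.
rewrite mulmxN mulmxA mulmxV // mul1mx.
apply/eqP; rewrite addrC subr_eq0; apply/eqP.
rewrite [RHS](reindex_inj rev_ord_inj) /=.
apply: eq_bigr => i _; rewrite nth_mps_inv_seq; last by rewrite subSS leq_subr.
by congr (A _ *m mps_inv A _); rewrite /bump /=; have := ltn_ord i; lia.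
Qed.

End MatrixPowerSeries.

Section QAnalysis.
Variables (R : realType) (p : nat) (Omega : completedAlgClosureQp R p).

Definition in_Zp (x : Omega) : Prop := Zp_in (@pabs R p Omega) x.

Definition lim_seq (u : nat -> Omega) : Omega :=
  xget 0 [set l | cvg_seq_to (@pabs R p Omega) u l]%classic.

Definition Zp_binom (b : Omega) (k : nat) : Omega :=
  (\prod_(i < k) (b - i%:R)) / (k`!)%:R.

(* q^b = \sum_k binom(b, k) (q - 1)^k *)
Definition qpow (q b : Omega) : Omega :=
  lim_seq (fun N => \sum_(k < N) Zp_binom b k * (q - 1) ^+ k).

Definition qpoch (y q : Omega) (d : nat) : Omega := \prod_(i < d) (1 - y * q ^+ i).

Definition qint (q : Omega) (i : nat) : Omega := (1 - q ^+ i) / (1 - q).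

Definition qgamma_nat (q : Omega) (m : nat) : Omega :=
  (-1) ^+ m * \prod_(1 <= i < m | ~~ (p %| i)%N) qint q i.

Definition continuous_on_Zp (G : Omega -> Omega) : Prop :=
  forall x, in_Zp x -> forall e : R, 0 < e -> exists2 d : R, 0 < d &
    forall y, in_Zp y -> pabs (y - x) < d -> pabs (G y - G x) < e.

(* Koblitz's p-adic q-gamma function.  Only the values on Z_p, where the
   extension is unique, are meaningful. *)
Definition qgamma (q : Omega) : Omega -> Omega :=
  xget (fun=> 0) [set G | continuous_on_Zp G /\
                          forall m : nat, G m%:R = qgamma_nat q m]%classic.

(* The multiplicity of the factor 1 - q^e in (q^s; q^b)_oo *)
Definition pochinf_mult (s b e : nat) : int :=
  Posz (nat_of_bool ((s <= e) && (b %| e - s))%N).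

(* The net multiplicity of 1 - q^e in
     [ (q^(ph);q)_oo (q^(pm+1);q)_oo / ((q;q)_oo (q^(pm+ph);q)_oo) ]
     / [ (q^(ph);q^p)_oo (q^(pm+p);q^p)_oo / ((q^p;q^p)_oo (q^(pm+ph);q^p)_oo) ].
   The infinite products do not converge p-adically; only this formal
   quotient has a meaning. *)
Definition phi_ratio_mult (m h e : nat) : int :=
  (pochinf_mult (p * h) 1 e + pochinf_mult (p * m + 1) 1 e
   - pochinf_mult 1 1 e - pochinf_mult (p * m + p * h) 1 e)
  - (pochinf_mult (p * h) p e + pochinf_mult (p * m + p) p e
     - pochinf_mult p p e - pochinf_mult (p * m + p * h) p e).

Lemma phi_ratio_mult_eq0 (m h e : nat) :
  (p * (m + h + 1) <= e)%N -> phi_ratio_mult m h e = 0.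
Proof.
move=> he; rewrite /phi_ratio_mult /pochinf_mult !dvd1n !andbT.
have -> : (p * h <= e)%N by nia.
have -> : (p * m + p * h <= e)%N by nia.
have -> : (p * m + p <= e)%N by nia.
have -> : (p <= e)%N by nia.
have -> : (p * m + 1 <= e)%N = (1 <= e)%N.
  case: (posnP p) he => [-> _|p0 he]; first by rewrite mul0n.
  by apply/idP/idP; nia.
have dvE s : (p %| s)%N -> (s <= e)%N -> (p %| e - s)%N = (p %| e)%N.
  by move=> ps hs; rewrite dvdn_subl.
rewrite !dvE ?dvdn_add ?dvdn_mulr //; try nia.
Qed.

(* By the lemma above the omitted factors all have exponent 0. *)
Definition phi_ratio_nat (q : Omega) (m h : nat) : Omega :=
  \prod_(e < p * (m + h + 1)) (1 - q ^+ e) ^ phi_ratio_mult m h e.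

Definition continuous2_on_Zp (G : Omega -> Omega -> Omega) : Prop :=
  forall x y, in_Zp x -> in_Zp y -> forall e : R, 0 < e -> exists2 d : R, 0 < d &
    forall x' y', in_Zp x' -> in_Zp y' -> pabs (x' - x) < d -> pabs (y' - y) < d ->
      pabs (G x' y' - G x y) < e.

(* The arguments are m and h; only the values on Z_p x Z_p are meaningful. *)
Definition phi_ratio (q : Omega) : Omega -> Omega -> Omega :=
  xget (fun _ _ => 0) [set G | continuous2_on_Zp G /\
                        forall m h : nat, G m%:R h%:R = phi_ratio_nat q m h]%classic.

Section Intertwiner.
Variable n : nat.
Implicit Types (h q : Omega) (a : 'I_n -> Omega).

(* The coefficient of z^d in f_j *)
Definition f_coef h a q (j : 'I_n) (d : nat) : Omega :=
  \prod_(k < n) (qpoch (qpow q (a j - a k + h)) q d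
                 / qpoch (qpow q (a j - a k + 1)) q d).

(* Rows are numbered from 0: entry (i, j) of Psi'(h, a, q, z) is
   q^(i a_j) f_j(h, a, q, z q^i), and z^d contributes (q^i)^d. *)
Definition Psi' h a q : mps Omega n :=
  fun d => \matrix_(i < n, j < n)
    (qpow q (i%:R * a j) * (f_coef h a q j d * (q ^+ i) ^+ d)).

Definition Psi_denom_neq0 a q : Prop :=
  forall (j k : 'I_n) (d : nat), qpoch (qpow q (a j - a k + 1)) q d != 0.

(* diag_j (Phi(ph, pa, pa_j, q, z) / Phi(h, a, a_j, q^p, z^p)) *)
Definition Phi_ratio_diag h a q : 'M[Omega]_n :=
  diag_mx (\row_(j < n) \prod_(k < n) phi_ratio q (a j - a k) h).

Definition scale_p a : 'I_n -> Omega := fun i => p%:R * a i.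

Definition U_generic h a q : mps Omega n :=
  mps_mul (mps_mul (Psi' (p%:R * h) (scale_p a) q)
                   (mps_const (Phi_ratio_diag h a q)))
          (mps_inv (mps_subst_pow p (Psi' h a (q ^+ p)))).

(* Omitting q = 1, where [i]_q and the ratio of the Phi's are 0/0 *)
Definition admissible h a q : Prop :=
  [/\ in_Zp h, forall i, in_Zp (a i) & 0 < pabs (q - 1) < 1].

(* A power series matrix is invertible iff its constant term is. *)
Definition generic h a q : Prop :=
  [/\ admissible h a q,
      Psi_denom_neq0 (scale_p a) q,
      Psi_denom_neq0 a (q ^+ p) &
      Psi' h a (q ^+ p) 0%N \in unitmx].

Definition is_generic_limit h a q (k : nat) (M : 'M[Omega]_n) : Prop :=
  forall e : R, 0 < e -> exists2 d : R, 0 < d &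
    forall h' a' q', generic h' a' q' ->
      pabs (h' - h) < d -> (forall i, pabs (a' i - a i) < d) -> pabs (q' - q) < d ->
      forall i j, pabs (U_generic h' a' q' k i j - M i j) < e.

(* The power series U(h, a, q, z): a coefficient at non-generic values is the
   limit of the coefficient from generic values. *)
Definition frobU h a q : mps Omega n := fun k =>
  if `[< generic h a q >] then U_generic h a q k
  else xget 0 [set M | is_generic_limit h a q k M]%classic.

(* (1, q^(p a_i), ..., q^((n-1) p a_i))^T *)
Definition fixed_pt a q (i : 'I_n) : 'cV[Omega]_n :=
  \col_(k < n) qpow q (k%:R * (p%:R * a i)).

Definition U0_eigenvalue h a q (i : 'I_n) : Omega :=
  \prod_(j < n) (qgamma q (p%:R * (a i - a j + h))
                 / (qgamma q (p%:R * (a i - a j)) * qgamma q (p%:R * h))).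

End Intertwiner.
End QAnalysis.

(* Main.v *)
Require Import Defs.
From mathcomp Require Import all_boot all_order all_algebra zify ring lra.
From mathcomp Require Import boolp classical_sets reals.

(* Put x_i = q^(p a_i).  The columns v_i form the Vandermonde matrix V of the x_i, and
   U(0) = V diag(phi_i) V^-1, where phi_i is the product over k of the middle ratios at
   m = a_i - a_k.  Cancelling the factors 1 - q^e with p | e, the middle ratio at m, h is
   Gamma(p(m+h)) / (Gamma(pm) Gamma(ph)), first on N x N and then on Z_p x Z_p by continuity,
   so phi_i is the eigenvalue.  Koblitz's gamma function exists because the product of [e]_q
   over p^N consecutive e prime to p tends to (-1)^p, uniformly, as N grows: the case N = 1
   is Wilson's theorem modulo the maximal ideal, and passing from N to N + 1 is almost a
   p-th power.

   At non-generic parameters the x_i may coincide (q may be a root of unity), so V may be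
   singular.  For h a natural number phi_i is a product of factors
   ([e]_q - q^e (x_i / x_j - 1) / (1 - q)) / [e]_q, that is, a polynomial in x_i, hence
   V diag(phi_i) V^-1 is the same polynomial in the companion matrix of the x_i.  That
   polynomial makes sense and is continuous everywhere, and it maps v_i to phi_i v_i.
   The convergence of products over windows holds with [e]_q replaced by [e]_q - q^e Z for
   a matrix Z of norm < 1; thus the polynomial is uniformly continuous in h, and the
   limit from generic parameters exists for all h in Z_p. *)

Set Implicit Arguments.
Unset Strict Implicit.
Unset Printing Implicit Defensive.

Import Order.TTheory GRing.Theory Num.Theory.
Local Open Scope ring_scope.

(** * Ultrametric absolute values and limits of sequences *)

Section AbsoluteValue.
Variables (R : realType) (p : nat) (Omega : completedAlgClosureQp R p).
Implicit Types (x y z : Omega) (u v : nat -> Omega) (r : R).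
Local Notation abs := (@pabs R p Omega).
Local Notation cvg := (cvg_seq_to abs).

Lemma abs0 : abs 0 = 0.
Proof. by apply/pabs_eq0. Qed.

Lemma abs_neq0 x : (abs x != 0) = (x != 0).
Proof. by congr (~~ _); apply/eqP/eqP => [/pabs_eq0 //|->]; exact: abs0. Qed.

Lemma abs_gt0 x : (0 < abs x) = (x != 0).
Proof. by rewrite lt_neqAle pabs_ge0 andbT eq_sym abs_neq0. Qed.

Lemma abs1 : abs 1 = 1.
Proof.
have n0 : abs 1 != 0 by rewrite abs_neq0 oner_eq0.
by apply: (mulfI n0); rewrite -pabsM !mulr1.
Qed.

Lemma absX x n : abs (x ^+ n) = abs x ^+ n.
Proof. by elim: n => [|n IH]; rewrite ?expr0 ?abs1 // !exprS pabsM IH. Qed.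

Lemma absN1 : abs (-1) = 1.
Proof.
have : abs (-1) ^+ 2 = 1 by rewrite -absX sqrrN expr1n abs1.
by move/eqP; rewrite sqrf_eq1 => /orP[/eqP//|/eqP e]; have := pabs_ge0 (-1 : Omega); rewrite e; lra.
Qed.

Lemma absN x : abs (- x) = abs x.
Proof. by rewrite -mulN1r pabsM absN1 mul1r. Qed.

Lemma absBC x y : abs (x - y) = abs (y - x).
Proof. by rewrite -absN opprB. Qed.

Lemma absV x : abs x^-1 = (abs x)^-1.
Proof.
have [->|n0] := eqVneq x 0; first by rewrite invr0 abs0 invr0.
apply: (@mulfI _ (abs x)); first by rewrite abs_neq0.
by rewrite -pabsM !mulfV ?abs_neq0 // abs1.
Qed.

Lemma absf_div x y : abs (x / y) = abs x / abs y.
Proof. by rewrite pabsM absV. Qed.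

Lemma abs_sign n : abs ((-1) ^+ n) = 1.
Proof. by rewrite absX absN1 expr1n. Qed.

Lemma absD_le r x y : abs x <= r -> abs y <= r -> abs (x + y) <= r.
Proof. by move=> hx hy; apply: le_trans (pabsD x y) _; rewrite ge_max hx. Qed.

Lemma absB_le r x y : abs x <= r -> abs y <= r -> abs (x - y) <= r.
Proof. by move=> hx hy; apply: absD_le; rewrite ?absN. Qed.

Lemma absD_lt r x y : abs x < r -> abs y < r -> abs (x + y) < r.
Proof. by move=> hx hy; apply: le_lt_trans (pabsD x y) _; rewrite gt_max hx. Qed.

Lemma absB_lt r x y : abs x < r -> abs y < r -> abs (x - y) < r.
Proof. by move=> hx hy; apply: absD_lt; rewrite ?absN. Qed.

Lemma abs_tri_le r y x z : abs (x - y) <= r -> abs (y - z) <= r -> abs (x - z) <= r.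
Proof. by move=> hx hy; rewrite -(subrKA y x); apply: absD_le. Qed.

Lemma abs_tri_lt r y x z : abs (x - y) < r -> abs (y - z) < r -> abs (x - z) < r.
Proof. by move=> hx hy; rewrite -(subrKA y x); apply: absD_lt. Qed.

Lemma abs_sum (I : Type) (s : seq I) (P : pred I) (F : I -> Omega) r :
  0 <= r -> (forall i, P i -> abs (F i) <= r) -> abs (\sum_(i <- s | P i) F i) <= r.
Proof.
move=> r0 h; apply: (big_ind (fun x => abs x <= r)) => //; first by rewrite abs0.
by move=> *; apply: absD_le.
Qed.

Lemma abs_nat_le1 n : abs n%:R <= 1.
Proof. by elim: n => [|n IH]; rewrite ?abs0 ?ler01 // -addn1 natrD absD_le // abs1. Qed.

Lemma abs_int_le1 (m : int) : abs m%:~R <= 1.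
Proof. by case: m => n; rewrite ?NegzE ?mulrNz ?absN abs_nat_le1. Qed.

(** In an ultrametric triangle the two longest sides have equal length. *)
Lemma abs_near x y : abs (x - y) < abs y -> abs x = abs y.
Proof.
move=> h; apply/eqP; rewrite eq_le; apply/andP; split.
  by rewrite -(subrK y x); apply: absD_le => //; apply: ltW.
rewrite leNgt; apply/negP => hx; suff: abs y < abs y by rewrite ltxx.
by have := absB_lt hx h; rewrite subKr.
Qed.

Lemma abs_prod (I : Type) (s : seq I) (P : pred I) (F : I -> Omega) :
  abs (\prod_(i <- s | P i) F i) = \prod_(i <- s | P i) abs (F i).
Proof. by apply: (big_morph abs) => [x y|]; rewrite ?pabsM ?abs1. Qed.

Lemma cvg_cst x : cvg (fun=> x) x.
Proof. by move=> e e0; exists 0%N => k _; rewrite subrr abs0. Qed.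

Lemma cvg_ext u v x : u =1 v -> cvg u x -> cvg v x.
Proof. by move=> uv h e /h[N hN]; exists N => k /hN; rewrite uv. Qed.

Lemma cvgD u v x y : cvg u x -> cvg v y -> cvg (fun k => u k + v k) (x + y).
Proof.
move=> hu hv e e0; have [[N hN] [M hM]] := (hu e e0, hv e e0).
exists (maxn N M) => k; rewrite geq_max => /andP[/hN h1 /hM h2].
by rewrite opprD addrACA absD_lt.
Qed.

Lemma cvgN u x : cvg u x -> cvg (fun k => - u k) (- x).
Proof. by move=> h e /h[N hN]; exists N => k /hN; rewrite -opprD absN. Qed.

Lemma cvgB u v x y : cvg u x -> cvg v y -> cvg (fun k => u k - v k) (x - y).
Proof. by move=> hu hv; apply: cvgD => //; apply: cvgN. Qed.

Lemma cvg_abs_le r u x : cvg u x -> (exists N, forall k, (N <= k)%N -> abs (u k) <= r) ->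
  abs x <= r.
Proof.
move=> hu [M hM]; rewrite leNgt; apply/negP => h.
have r0 : 0 <= r by apply: le_trans (pabs_ge0 _) (hM M (leqnn M)).
have [N hN] := hu _ (le_lt_trans r0 h).
have E := abs_near (hN _ (leq_maxl N M)).
by have := hM _ (leq_maxr N M); rewrite E leNgt h.
Qed.

(** By the isosceles principle the absolute value is eventually constant along a sequence with
    nonzero limit. *)
Lemma cvg_abs_eq u x : cvg u x -> x != 0 -> exists N, forall k, (N <= k)%N -> abs (u k) = abs x.
Proof.
by rewrite -abs_gt0 => h /h[N hN]; exists N => k /hN /abs_near.
Qed.

Lemma cvgM u v x y : cvg u x -> cvg v y -> cvg (fun k => u k * v k) (x * y).
Proof.
move=> hu hv e e0.
pose b := abs x + 1; pose c := abs y + 1.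
have b0 : 0 < b by rewrite ltr_wpDl ?pabs_ge0.
have c0 : 0 < c by rewrite ltr_wpDl ?pabs_ge0.
have [N hN] := hu (Num.min 1 (e / c)) ltac:(by rewrite lt_min ltr01 divr_gt0).
have [M hM] := hv (e / b) ltac:(by rewrite divr_gt0).
exists (maxn N M) => k; rewrite geq_max => /andP[/hN + /hM h2].
rewrite lt_min => /andP[h1 h1'].
have -> : u k * v k - x * y = u k * (v k - y) + (u k - x) * y by ring.
apply: absD_lt; rewrite pabsM.
  have ub : abs (u k) <= b.
    rewrite -(subrK x (u k)); apply: absD_le; rewrite /b ?lerDl //.
    by apply: le_trans (ltW h1) _; rewrite lerDr pabs_ge0.
  apply: le_lt_trans (ler_wpM2r (pabs_ge0 _) ub) _.
  by rewrite mulrC -ltr_pdivlMr.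
apply: le_lt_trans (ler_wpM2l (pabs_ge0 _) (_ : abs y <= c)) _.
  by rewrite lerDl.
by rewrite -ltr_pdivlMr.
Qed.

Lemma cvgV u x : cvg u x -> x != 0 -> cvg (fun k => (u k)^-1) x^-1.
Proof.
move=> hu x0 e e0; have ax : 0 < abs x by rewrite abs_gt0.
have [M hM] := cvg_abs_eq hu x0.
have [N hN] := hu (e * abs x ^+ 2) ltac:(by rewrite mulr_gt0 ?exprn_gt0).
exists (maxn N M) => k; rewrite geq_max => /andP[/hN h1 /hM h2].
have uk0 : u k != 0 by rewrite -abs_neq0 h2 abs_neq0.
have -> : (u k)^-1 - x^-1 = (x - u k) / (u k * x) by field; rewrite uk0 x0.
by rewrite absf_div pabsM h2 absBC ltr_pdivrMr ?mulr_gt0 // -expr2.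
Qed.

Lemma cvg_div u v x y : cvg u x -> cvg v y -> y != 0 -> cvg (fun k => u k / v k) (x / y).
Proof. by move=> hu hv y0; apply: cvgM => //; apply: cvgV. Qed.

Lemma cvg_sum (I : Type) (s : seq I) (P : pred I) (F : I -> nat -> Omega) (L : I -> Omega) :
  (forall i, P i -> cvg (F i) (L i)) ->
  cvg (fun k => \sum_(i <- s | P i) F i k) (\sum_(i <- s | P i) L i).
Proof.
move=> h; elim: s => [|i s IH].
  by rewrite big_nil; apply: cvg_ext (cvg_cst 0) => k; rewrite big_nil.
rewrite big_cons; case: ifP => Pi.
  apply: cvg_ext (cvgD (h i Pi) IH) => k.
  by rewrite big_cons Pi.
by apply: cvg_ext IH => k; rewrite big_cons Pi.
Qed.

Lemma cvg_prod (I : Type) (s : seq I) (P : pred I) (F : I -> nat -> Omega) (L : I -> Omega) :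
  (forall i, P i -> cvg (F i) (L i)) ->
  cvg (fun k => \prod_(i <- s | P i) F i k) (\prod_(i <- s | P i) L i).
Proof.
move=> h; elim: s => [|i s IH].
  by rewrite big_nil; apply: cvg_ext (cvg_cst 1) => k; rewrite big_nil.
rewrite big_cons; case: ifP => Pi.
  apply: cvg_ext (cvgM (h i Pi) IH) => k.
  by rewrite big_cons Pi.
by apply: cvg_ext IH => k; rewrite big_cons Pi.
Qed.

Lemma cvg_unique u x y : cvg u x -> cvg u y -> x = y.
Proof.
move=> hx hy; apply/eqP; rewrite -subr_eq0; apply/eqP/(@pabs_eq0 R p); apply/eqP.
rewrite eq_le pabs_ge0 andbT.
by apply: (cvg_abs_le (cvgB hx hy)); exists 0%N => k _; rewrite subrr abs0.
Qed.

Lemma lim_seqE u x : cvg u x -> lim_seq u = x.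
Proof.
move=> h; rewrite /lim_seq; case: xgetP => [y _ /= hy|/(_ x)//].
exact: cvg_unique hy h.
Qed.

Lemma small_abs_eq0 x : (forall e, 0 < e -> abs x <= e) -> x = 0.
Proof.
move=> h; apply/(@pabs_eq0 R p); apply/eqP; rewrite eq_le pabs_ge0 andbT.
by rewrite leNgt; apply/negP => /[dup] x0 /(fun h => divr_gt0 h (ltr0Sn R 1)) /h; lra.
Qed.

(** By the ultrametric inequality the limit inherits the Cauchy rate without loss. The powers q^b,
    the gamma function and the limit matrix are all obtained in this way. *)
Lemma cauchy_rate u (f : nat -> R) :
  (forall e, 0 < e -> exists N, forall k, (N <= k)%N -> f k < e) ->
  (forall k l, (k <= l)%N -> abs (u l - u k) <= f k) ->
  exists2 x, cvg u x & forall k, abs (x - u k) <= f k.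
Proof.
move=> hf hu.
have [|x hx] := @pabs_complete R p Omega u.
  move=> e /hf[N hN]; exists N => k l Nk Nl.
  apply: (@abs_tri_lt _ (u N)); last rewrite absBC.
    by apply: le_lt_trans (hu _ _ Nk) (hN _ _).
  by apply: le_lt_trans (hu _ _ Nl) (hN _ _).
exists x => // k; apply: (cvg_abs_le (cvgB hx (cvg_cst (u k)))).
by exists k => l; apply: hu.
Qed.

End AbsoluteValue.

(** * Geometric sequences tending to zero *)

Section PowersToZero.
Variable R : realType.

Lemma expr_lt_eps (t e : R) : 0 <= t < 1 -> 0 < e ->
  exists N : nat, forall k, (N <= k)%N -> t ^+ k < e.
Proof.
move=> /andP[t0 t1] e0.
have [->|tn0] := eqVneq t 0.
  by exists 1%N => -[//|k] _; rewrite expr0n.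
have tp : 0 < t by rewrite lt_neqAle eq_sym tn0.
(* Bernoulli's inequality is applied to the powers of 1/t = 1 + d. *)
pose d := t^-1 - 1.
have d0 : 0 < d by rewrite subr_gt0 invf_gt1.
have bern n : 1 + n%:R * d <= (1 + d) ^+ n.
  elim: n => [|n IH]; first by rewrite mul0r addr0 expr0.
  rewrite exprS -natr1.
  have: (1 + d) * (1 + n%:R * d) <= (1 + d) * (1 + d) ^+ n by rewrite ler_wpM2l // addr_ge0 // ltW.
  apply: le_trans.
  have: 0 <= n%:R * d * d by rewrite !mulr_ge0 // ltW.
  by nra.
pose N := Num.bound (e^-1 / d).
exists N => k Nk.
have h : e^-1 < k%:R * d.
  rewrite -ltr_pdivrMr //; apply: lt_le_trans (_ : N%:R <= _); last by rewrite ler_nat.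
  by rewrite /N archi_boundP // divr_ge0 // ?invr_ge0 ltW.
have dE : 1 + d = t^-1 by rewrite /d addrC subrK.
have hb := bern k; rewrite dE in hb.
have : e^-1 < t^-1 ^+ k by apply: lt_le_trans hb; lra.
by rewrite exprVn ltf_pV2 ?posrE ?exprn_gt0.
Qed.

Lemma cexpr_lt_eps (c t e : R) : 0 <= c -> 0 <= t < 1 -> 0 < e ->
  exists N : nat, forall k, (N <= k)%N -> c * t ^+ k < e.
Proof.
move=> c0 t01 e0.
have [N hN] := expr_lt_eps t01 (divr_gt0 e0 (ltr_wpDl c0 ltr01)).
exists N => k /hN; rewrite ltr_pdivlMr ?ltr_wpDl // mulrC.
apply: le_lt_trans; rewrite ler_wpM2r ?lerDl //.
by rewrite exprn_ge0 //; case/andP: t01.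
Qed.

End PowersToZero.

(** * The ring Z_p inside Omega *)

Section PadicIntegers.
Variables (R : realType) (p : nat).
Hypothesis p_prime : prime p.
Variable Omega : completedAlgClosureQp R p.
Implicit Types (x y z b c q : Omega) (u v : nat -> Omega) (r : R).
Local Notation abs := (@pabs R p Omega).
Local Notation cvg := (cvg_seq_to abs).
Local Notation pinv := (p%:R^-1 : R).

Lemma pinv_gt0 : 0 < pinv.
Proof. by rewrite invr_gt0 ltr0n prime_gt0. Qed.

Lemma pinv_lt1 : pinv < 1.
Proof. by rewrite invf_lt1 ?ltr0n ?prime_gt0 // ltr1n prime_gt1. Qed.

Lemma pinv_exp_small r : 0 < r -> exists N, forall k, (N <= k)%N -> pinv ^+ k < r.
Proof. by apply: expr_lt_eps; rewrite ltW ?pinv_gt0 ?pinv_lt1. Qed.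

(** Bezout gives an inverse [km] of [m] modulo p. As |km m| = 1 and neither factor exceeds 1, both
    have absolute value 1. *)
Lemma abs_nat_unit m : ~~ (p %| m)%N -> abs m%:R = 1.
Proof.
move=> pm; have m0 : (0 < m)%N by case: m pm => //; rewrite dvdn0.
have := pm; rewrite -prime_coprime // coprime_sym => /eqP cop.
have [km kn /= E _] := egcdnP p m0; rewrite cop in E.
have hE : abs km%:R * abs m%:R = 1.
  rewrite -pabsM -natrM E natrD -[RHS](@abs1 R p Omega); apply: abs_near.
  rewrite addrK natrM pabsM pabs_p abs1.
  apply: le_lt_trans (_ : 1 * p%:R^-1 < 1); last by rewrite mul1r pinv_lt1.
  by rewrite ler_wpM2r ?abs_nat_le1 // ltW ?pinv_gt0.
apply/eqP; rewrite eq_le abs_nat_le1 /= leNgt; apply/negP => h.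
suff : abs km%:R * abs m%:R < 1 by rewrite hE ltxx.
apply: le_lt_trans h; rewrite -{2}[abs m%:R]mul1r ler_wpM2r ?pabs_ge0 //.
exact: abs_nat_le1.
Qed.

Lemma abs_natE m : (0 < m)%N -> abs m%:R = pinv ^+ logn p m.
Proof.
move=> m0; have [m' cop {1}->] := pfactor_coprime p_prime m0.
rewrite natrM pabsM natrX absX pabs_p abs_nat_unit ?mul1r //.
by rewrite -prime_coprime.
Qed.

Lemma natr_Omega_neq0 m : (m%:R == 0 :> Omega) = (m == 0)%N.
Proof.
case: m => [|m]; first by rewrite !eqxx.
by apply/negP => /eqP; move/(congr1 abs)/eqP; rewrite abs0 abs_natE // expf_eq0 gt_eqF ?pinv_gt0 ?andbF.
Qed.

Lemma intr_Omega_eq0 (m : int) : (m%:~R == 0 :> Omega) = (m == 0).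
Proof. by case: m => m; rewrite ?NegzE ?mulrNz ?oppr_eq0 natr_Omega_neq0. Qed.

Lemma abs_nat_le_exp N m : (abs m%:R <= pinv ^+ N) = (p ^ N %| m)%N.
Proof.
case: m => [|m].
  by rewrite abs0 dvdn0 exprn_ge0 // ltW ?pinv_gt0.
rewrite abs_natE // pfactor_dvdn // ler_iXn2l ?pinv_gt0 ?pinv_lt1 //.
Qed.

Lemma abs_natB_le_exp N m l : (abs (m%:R - l%:R) <= pinv ^+ N) = (m == l %[mod p ^ N])%N.
Proof.
wlog h : m l / (l <= m)%N => [H|].
  by case/orP: (leq_total l m) => h; [exact: H | rewrite absBC eq_sym H].
by rewrite -natrB // abs_nat_le_exp eqn_mod_dvd.
Qed.

(** Reducing an integer approximation modulo p^N makes it natural. This form is convenient because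
    powers of q and gamma values are first known at natural numbers. *)
Lemma in_ZpP x : in_Zp x <-> forall N, exists m : nat, abs (x - m%:R) <= pinv ^+ N.
Proof.
split=> [h N|h e e0]; last first.
  have [N hN] := pinv_exp_small e0; have [m hm] := h N.
  by exists m%:R; [exists m; rewrite pmulrn | apply: le_lt_trans hm (hN _ _)].
have [_ [m ->] hm] := h _ (exprn_gt0 N pinv_gt0).
exists `|(m %% (p ^ N)%:Z)%Z|%N.
apply: (@abs_tri_le _ _ _ _ m%:~R); first exact: ltW.
have pN : (p ^ N)%:Z != 0 by rewrite eqz_nat -lt0n expn_gt0 prime_gt0.
rewrite pmulrn gez0_abs ?modz_ge0 // {1}(divz_eq m (p ^ N)%:Z) rmorphD rmorphM /= addrK.
rewrite pabsM -[X in _ <= X]mul1r ler_pM ?pabs_ge0 ?abs_int_le1 //.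
by rewrite -pmulrn abs_nat_le_exp.
Qed.

Lemma in_Zp_nat m : in_Zp (m%:R : Omega).
Proof. by apply/in_ZpP => N; exists m; rewrite subrr abs0 exprn_ge0 // ltW ?pinv_gt0. Qed.

Lemma in_ZpD x y : in_Zp x -> in_Zp y -> in_Zp (x + y).
Proof.
move=> /in_ZpP hx /in_ZpP hy; apply/in_ZpP => N.
have [[m hm] [l hl]] := (hx N, hy N); exists (m + l)%N.
by rewrite natrD opprD addrACA absD_le.
Qed.

Lemma in_Zp_abs_le1 x : in_Zp x -> abs x <= 1.
Proof.
move=> /in_ZpP/(_ 0%N)[m hm]; rewrite expr0 in hm.
by rewrite -(subrK m%:R x) absD_le ?abs_nat_le1.
Qed.

Lemma in_ZpM x y : in_Zp x -> in_Zp y -> in_Zp (x * y).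
Proof.
move=> hx hy; have x1 := in_Zp_abs_le1 hx.
move/in_ZpP: hx => hx; move/in_ZpP: hy => hy; apply/in_ZpP => N.
have [[m hm] [l hl]] := (hx N, hy N); exists (m * l)%N.
have -> : x * y - (m * l)%:R = x * (y - l%:R) + (x - m%:R) * l%:R by rewrite natrM; ring.
by rewrite absD_le // pabsM; [rewrite -[X in _ <= X]mul1r|rewrite -[X in _ <= X]mulr1];
  rewrite ler_pM ?pabs_ge0 ?abs_nat_le1.
Qed.

Lemma in_ZpN1 : in_Zp (-1 : Omega).
Proof.
apply/in_ZpP => N; exists (p ^ N - 1)%N.
rewrite natrB ?expn_gt0 ?prime_gt0 // opprB addKr absN.
by rewrite abs_nat_le_exp.
Qed.

Lemma in_ZpN x : in_Zp x -> in_Zp (- x).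
Proof. by move=> h; rewrite -mulN1r; apply: in_ZpM => //; apply: in_ZpN1. Qed.

Lemma in_ZpB x y : in_Zp x -> in_Zp y -> in_Zp (x - y).
Proof. by move=> hx hy; apply: in_ZpD => //; apply: in_ZpN. Qed.

(** The inverses of m modulo p^N given by Bezout approximate 1/m. *)
Lemma in_Zp_natV m : ~~ (p %| m)%N -> in_Zp (m%:R^-1 : Omega).
Proof.
move=> pm; have m1 := abs_nat_unit pm; apply/in_ZpP => N.
have m0 : (0 < m)%N by case: m pm {m1} => //; rewrite dvdn0.
have cop : coprime m (p ^ N) by rewrite coprime_sym coprimeXl // prime_coprime.
have [km kn /= E _] := egcdnP (p ^ N) m0; rewrite (eqP cop) in E.
exists km; have -> : m%:R^-1 - km%:R = - (kn * p ^ N)%:R / m%:R :> Omega.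
  have E' := congr1 (fun k => k%:R : Omega) E; rewrite /= natrD natrM in E'.
  have mn0 : m%:R != 0 :> Omega by rewrite natr_Omega_neq0 -lt0n.
  apply: (mulIf mn0); rewrite mulrBl E' mulVf // -mulrA mulVf //; ring.
by rewrite absf_div m1 divr1 absN abs_nat_le_exp dvdn_mull.
Qed.

Lemma Zp_seq x : in_Zp x -> exists w : nat -> nat, forall k, abs (x - (w k)%:R) <= pinv ^+ k.
Proof. by move/in_ZpP/choice => -[w]; exists w. Qed.

Lemma cvg_rate u x : (forall k, abs (x - u k) <= pinv ^+ k) -> cvg u x.
Proof.
move=> h e /pinv_exp_small[N hN]; exists N => k /hN.
by rewrite absBC; apply: le_lt_trans.
Qed.

(** * The powers q^b with b in Z_p *)

Section QPower.

Variables (theta : R) (q : Omega).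
Hypotheses (theta_ge : pinv <= theta) (theta_lt1 : theta < 1) (q_theta : abs (q - 1) <= theta).

Lemma theta_ge0 : 0 <= theta.
Proof. by apply: le_trans theta_ge; rewrite ltW ?pinv_gt0. Qed.

Lemma q_lt1 : abs (q - 1) < 1.
Proof. exact: le_lt_trans theta_lt1. Qed.

Lemma abs_q : abs q = 1.
Proof. by rewrite -(@abs1 R p Omega); apply: abs_near; rewrite abs1 q_lt1. Qed.

Lemma expr_sub1 y n : y ^+ n - 1 = (y - 1) * \sum_(i < n) y ^+ i.
Proof. by rewrite subrX1. Qed.

Lemma abs_qX_sub1 n : abs (q ^+ n - 1) <= abs (q - 1).
Proof.
rewrite expr_sub1 pabsM ler_piMr ?pabs_ge0 // abs_sum // => i _.
by rewrite absX abs_q expr1n.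
Qed.

(** With y = q^(p^N), y^p - 1 = (y - 1)(1 + y + ... + y^(p-1)), and the second factor is congruent
    to p modulo y - 1. As [theta] dominates both |p| and |q - 1|, each p-th power gains a factor
    [theta]. *)
Lemma abs_qXp_sub1 N : abs (q ^+ (p ^ N) - 1) <= abs (q - 1) * theta ^+ N.
Proof.
have t0 := theta_ge0; elim: N => [|N IH]; first by rewrite expn0 expr0 mulr1.
have IH' : abs (q ^+ (p ^ N) - 1) <= theta.
  apply: le_trans IH _; apply: le_trans q_theta.
  by rewrite ler_piMr ?pabs_ge0 // exprn_ile1 // ltW.
rewrite expnSr exprM expr_sub1 pabsM exprSr mulrA ler_pM ?pabs_ge0 //.
have -> : \sum_(i < p) (q ^+ (p ^ N)) ^+ i = p%:R + \sum_(i < p) ((q ^+ (p ^ N)) ^+ i - 1).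
  by rewrite sumrB sumr_const card_ord addrC subrK.
apply: absD_le; first by rewrite pabs_p.
apply: abs_sum => // i _; rewrite -exprM mulnC exprM; set y := q ^+ i.
have y1 : abs y = 1 by rewrite absX abs_q expr1n.
rewrite -exprM mulnC exprM expr_sub1 pabsM -[X in _ <= X]mulr1 ler_pM ?pabs_ge0 //.
by apply: abs_sum => // j _; rewrite !absX abs_q !expr1n.
Qed.

Lemma abs_qX_cong m l N : m = l %[mod p ^ N]%N -> abs (q ^+ m - q ^+ l) <= abs (q - 1) * theta ^+ N.
Proof.
wlog h : m l / (l <= m)%N => [H|] e.
  by case/orP: (leq_total l m) => h; [exact: H | rewrite absBC; apply: H].
have /dvdnP[k kE] : (p ^ N %| m - l)%N by rewrite -eqn_mod_dvd // e.
rewrite -(subnK h) kE exprD -{2}[q ^+ l]mul1r -mulrBl pabsM absX abs_q expr1n mulr1.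
rewrite mulnC exprM expr_sub1 pabsM -[X in _ <= X]mulr1 ler_pM ?pabs_ge0 ?abs_qXp_sub1 //.
by apply: abs_sum => // j _; rewrite !absX abs_q !expr1n.
Qed.

End QPower.

Definition theta_of q : R := Num.max (abs (q - 1)) pinv.

Lemma theta_of_ge q : pinv <= theta_of q.
Proof. by rewrite le_max lexx orbT. Qed.

Lemma theta_of_lt1 q : abs (q - 1) < 1 -> theta_of q < 1.
Proof. by move=> h; rewrite gt_max h pinv_lt1. Qed.

Lemma theta_of_q q : abs (q - 1) <= theta_of q.
Proof. by rewrite le_max lexx. Qed.

Lemma Zp_binom_nat m k : Zp_binom (m%:R : Omega) k = 'C(m, k)%:R.
Proof.
rewrite /Zp_binom; apply: (canLR (mulfK _)).
  by rewrite natr_Omega_neq0 -lt0n fact_gt0.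
rewrite -natrM bin_ffact; elim: k => [|k IH]; first by rewrite big_ord0.
rewrite big_ord_recr /= IH ffactnSr natrM; have [km|mk] := leqP k m; first by rewrite natrB.
by rewrite ffact_small // !mul0r.
Qed.

Lemma cvg_Zp_binom u b k : cvg u b -> cvg (fun j => Zp_binom (u j) k) (Zp_binom b k).
Proof.
move=> h; apply: cvgM; last exact: cvg_cst.
by apply: cvg_prod => i _; apply: cvgB => //; apply: cvg_cst.
Qed.

(** At natural numbers the values are integers; a polynomial in [b] is continuous, so the bound
    extends to Z_p. *)
Lemma abs_Zp_binom b k : in_Zp b -> abs (Zp_binom b k) <= 1.
Proof.
move=> /Zp_seq[w hw]; apply: (cvg_abs_le (cvg_Zp_binom k (cvg_rate hw))).
by exists 0%N => j _; rewrite Zp_binom_nat abs_nat_le1.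
Qed.

Definition qpow_part q b N : Omega := \sum_(k < N) Zp_binom b k * (q - 1) ^+ k.

Lemma qpow_part_nat q m N : (m < N)%N -> qpow_part q m%:R N = q ^+ m.
Proof.
move=> mN; rewrite -{2}(addrNK 1 q) addrC exprDn /qpow_part.
rewrite -(big_mkord xpredT (fun k => Zp_binom m%:R k * (q - 1) ^+ k)).
rewrite (@big_cat_nat _ _ _ m.+1) //= [X in _ + X]big1_seq ?addr0.
  rewrite big_mkord; apply: eq_bigr => i _.
  by rewrite Zp_binom_nat expr1n mul1r mulr_natl.
move=> i; rewrite mem_index_iota => /andP[_ /andP[mi _]].
by rewrite Zp_binom_nat bin_small // mul0r.
Qed.

(** Integrality of the binomials bounds the tail by the first omitted power of q - 1. The rate is
    uniform in [b], which yields continuity in [b]. *)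
Lemma qpow_partP q b N : abs (q - 1) < 1 -> in_Zp b ->
  cvg (qpow_part q b) (qpow q b) /\ abs (qpow q b - qpow_part q b N) <= abs (q - 1) ^+ N.
Proof.
move=> q1 hb.
have [|k l kl|x hx hr] := @cauchy_rate _ _ _ (qpow_part q b) (fun k => abs (q - 1) ^+ k).
- by move=> e; apply: expr_lt_eps; rewrite pabs_ge0.
- rewrite /qpow_part -!(big_mkord xpredT (fun k => Zp_binom b k * (q - 1) ^+ k)).
  rewrite (@big_cat_nat _ _ _ k 0 l) //= addrAC subrr add0r.
  rewrite big_nat_cond abs_sum ?exprn_ge0 ?pabs_ge0 // => i; rewrite andbT => /andP[ki _].
  rewrite pabsM absX -[X in _ <= X]mul1r ler_pM ?exprn_ge0 ?pabs_ge0 ?abs_Zp_binom //.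
  by rewrite ler_wiXn2l ?pabs_ge0 // ltW.
- by rewrite {1 2}/qpow (lim_seqE hx).
Qed.

Lemma qpow_nat q m : qpow q m%:R = q ^+ m.
Proof.
apply: lim_seqE => e e0; exists m.+1 => k mk.
by rewrite -/(qpow_part q m%:R k) qpow_part_nat // subrr abs0.
Qed.

Lemma cvg_qpow q u b : abs (q - 1) < 1 -> (forall k, in_Zp (u k)) -> in_Zp b ->
  cvg u b -> cvg (fun k => qpow q (u k)) (qpow q b).
Proof.
move=> q1 hu hb h e e0.
have [N hN] : exists N, forall k, (N <= k)%N -> abs (q - 1) ^+ k < e.
  by apply: expr_lt_eps; rewrite ?pabs_ge0.
have [M hM] : exists M, forall k, (M <= k)%N -> abs (qpow_part q (u k) N - qpow_part q b N) < e.
  suff : cvg (fun k => qpow_part q (u k) N) (qpow_part q b N) by apply.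
  by apply: cvg_sum => i _; apply: cvgM; [apply: cvg_Zp_binom | apply: cvg_cst].
exists M => k Mk; apply: (@abs_tri_lt _ _ _ _ (qpow_part q (u k) N)).
  by apply: le_lt_trans (hN N _) => //; have [] := qpow_partP N q1 (hu k).
apply: (@abs_tri_lt _ _ _ _ (qpow_part q b N)); first exact: hM.
by rewrite absBC; apply: le_lt_trans (hN N _) => //; have [] := qpow_partP N q1 hb.
Qed.

Lemma cvg_qpow_nat q (w : nat -> nat) b : abs (q - 1) < 1 -> in_Zp b ->
  cvg (fun k => (w k)%:R) b -> cvg (fun k => q ^+ w k) (qpow q b).
Proof.
move=> q1 hb h; apply: cvg_ext (cvg_qpow q1 _ hb h) => k; first by rewrite qpow_nat.
exact: in_Zp_nat.
Qed.

Lemma Zp_seq_cong b c (w w' : nat -> nat) N : (forall k, abs (b - (w k)%:R) <= pinv ^+ k) ->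
  (forall k, abs (c - (w' k)%:R) <= pinv ^+ k) -> abs (b - c) <= pinv ^+ N ->
  forall k, (N <= k)%N -> w k = w' k %[mod p ^ N]%N.
Proof.
move=> hw hw' bc k Nk; apply/eqP; rewrite -abs_natB_le_exp.
have kN : pinv ^+ k <= pinv ^+ N.
  by rewrite ler_wiXn2l // ltW ?pinv_gt0 ?pinv_lt1.
apply: (@abs_tri_le _ _ _ _ b); first by rewrite absBC; apply: le_trans kN.
by apply: (@abs_tri_le _ _ _ _ c) => //; apply: le_trans kN.
Qed.

(** From index N on, the natural approximations of b and c are congruent modulo p^N. The factor |q -
    1| is kept because differences of nodes are later divided by 1 - q. *)
Lemma qpow_lip theta q b c N : pinv <= theta -> theta < 1 -> abs (q - 1) <= theta ->
  in_Zp b -> in_Zp c -> abs (b - c) <= pinv ^+ N ->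
  abs (qpow q b - qpow q c) <= abs (q - 1) * theta ^+ N.
Proof.
move=> t1 t2 t3 hb hc bc; have q1 := q_lt1 t2 t3.
have [[w hw] [w' hw']] := (Zp_seq hb, Zp_seq hc).
apply: (cvg_abs_le (cvgB (cvg_qpow_nat q1 hb (cvg_rate hw)) (cvg_qpow_nat q1 hc (cvg_rate hw')))).
by exists N => k Nk; apply: abs_qX_cong => //; apply: Zp_seq_cong Nk.
Qed.

Lemma qpow0 q : qpow q 0 = 1.
Proof. by rewrite -[0]/(0%:R) qpow_nat. Qed.

Lemma qpowD q b c : abs (q - 1) < 1 -> in_Zp b -> in_Zp c ->
  qpow q (b + c) = qpow q b * qpow q c.
Proof.
move=> q1 hb hc; have [[w hw] [w' hw']] := (Zp_seq hb, Zp_seq hc).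
apply: (@cvg_unique _ _ _ (fun k => q ^+ (w k + w' k))).
  apply: cvg_qpow_nat => //; first exact: in_ZpD.
  by apply: cvg_ext (cvgD (cvg_rate hw) (cvg_rate hw')) => k; rewrite natrD.
apply: cvg_ext (cvgM (cvg_qpow_nat q1 hb (cvg_rate hw)) (cvg_qpow_nat q1 hc (cvg_rate hw'))) => k.
by rewrite exprD.
Qed.

Lemma qpow_natM q b m : abs (q - 1) < 1 -> in_Zp b -> qpow q (m%:R * b) = qpow q b ^+ m.
Proof.
move=> q1 hb; elim: m => [|m IH]; first by rewrite mul0r qpow0.
by rewrite -natr1 mulrDl mul1r qpowD ?IH ?exprSr //; apply: in_ZpM => //; apply: in_Zp_nat.
Qed.

Lemma abs_qpow q b : abs (q - 1) < 1 -> in_Zp b -> abs (qpow q b) = 1.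
Proof.
move=> q1 hb; have h : abs (qpow q b - 1) <= abs (q - 1).
  rewrite -{1}(qpow0 q) -[X in _ <= X]mulr1 -(expr0 (theta_of q)).
  apply: qpow_lip (theta_of_ge q) (theta_of_lt1 q1) (theta_of_q q) _ _ _ => //.
    exact: (in_Zp_nat 0).
  by rewrite subr0 expr0 in_Zp_abs_le1.
by rewrite -(@abs1 R p Omega); apply: abs_near; rewrite abs1; apply: le_lt_trans h _.
Qed.

Lemma qpow_neq0 q b : abs (q - 1) < 1 -> in_Zp b -> qpow q b != 0.
Proof. by move=> q1 hb; rewrite -abs_neq0 abs_qpow // oner_eq0. Qed.

Lemma qpowN q b : abs (q - 1) < 1 -> in_Zp b -> qpow q (- b) = (qpow q b)^-1.
Proof.
move=> q1 hb; apply: (mulfI (qpow_neq0 q1 hb)).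
by rewrite -(qpowD q1 hb (in_ZpN hb)) subrr qpow0 mulfV ?qpow_neq0.
Qed.

Lemma qpowB q b c : abs (q - 1) < 1 -> in_Zp b -> in_Zp c ->
  qpow q (b - c) = qpow q b / qpow q c.
Proof. by move=> q1 hb hc; rewrite qpowD ?(qpowN q1 hc) //; apply: (in_ZpN hc). Qed.

Lemma qX_lt1 q m : abs (q - 1) < 1 -> abs (q ^+ m - 1) < 1.
Proof.
move=> q1; apply: le_lt_trans (q1).
exact: abs_qX_sub1 (theta_of_lt1 q1) (theta_of_q q) _.
Qed.

Lemma qpow_expl q b m : abs (q - 1) < 1 -> in_Zp b -> qpow (q ^+ m) b = qpow q (m%:R * b).
Proof.
move=> q1 hb; have [w hw] := Zp_seq hb.
have hmb : in_Zp (m%:R * b) by apply: in_ZpM => //; apply: in_Zp_nat.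
apply: (@cvg_unique _ _ _ (fun k => (q ^+ m) ^+ w k)).
  by apply: cvg_qpow_nat (qX_lt1 m q1) hb (cvg_rate hw).
apply: cvg_ext (cvg_qpow_nat (w := fun k => (m * w k)%N) q1 hmb _) => k; first by rewrite exprM.
by apply: cvg_ext (cvgM (cvg_cst m%:R) (cvg_rate hw)) k => k; rewrite natrM.
Qed.

Lemma abs_exprB x y m r : abs x <= 1 -> abs y <= 1 -> abs (x - y) <= r ->
  abs (x ^+ m - y ^+ m) <= r.
Proof.
move=> x1 y1 h; have r0 := le_trans (pabs_ge0 _) h.
elim: m => [|m IH]; first by rewrite subrr abs0.
have -> : x ^+ m.+1 - y ^+ m.+1 = x * (x ^+ m - y ^+ m) + (x - y) * y ^+ m by rewrite !exprS; ring.
by rewrite absD_le // pabsM; [rewrite -[X in _ <= X]mul1r|rewrite -[X in _ <= X]mulr1];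
  rewrite ler_pM ?pabs_ge0 // absX exprn_ile1 ?pabs_ge0.
Qed.

Lemma qpow_lip_base q q' b : abs (q - 1) < 1 -> abs (q' - 1) < 1 -> in_Zp b ->
  abs (qpow q b - qpow q' b) <= abs (q - q').
Proof.
move=> q1 q1' hb; have [w hw] := Zp_seq hb.
apply: (cvg_abs_le (cvgB (cvg_qpow_nat q1 hb (cvg_rate hw)) (cvg_qpow_nat q1' hb (cvg_rate hw)))).
exists 0%N => k _; apply: abs_exprB => //.
  by rewrite (abs_q (theta_of_lt1 q1) (theta_of_q q)).
by rewrite (abs_q (theta_of_lt1 q1') (theta_of_q q')).
Qed.

(** For nonzero b the natural approximations are p^v m' with v eventually constant and m' prime to
    p. Then |q^(w k) - 1| = |q^(p^v) - 1| is a positive constant, so q^(w k) cannot tend to 1. *)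
Lemma qpow_eq1 q b : abs (q - 1) < 1 -> (forall N, q ^+ (p ^ N) != 1) -> in_Zp b ->
  qpow q b = 1 -> b = 0.
Proof.
move=> q1 hq hb qb; apply/eqP; apply/negP => /negP b0.
have [w hw] := Zp_seq hb.
have [N1 h1] := cvg_abs_eq (cvg_rate hw) b0.
have w0 k : (N1 <= k)%N -> (0 < w k)%N.
  move=> /h1 E; rewrite lt0n; apply/negP => /eqP w0; move: E; rewrite w0 abs0.
  by move/esym/eqP; apply/negP; rewrite abs_neq0.
pose v := logn p (w N1).
have logE k : (N1 <= k)%N -> logn p (w k) = v.
  move=> Nk; have := h1 k Nk; rewrite -(h1 N1) // !abs_natE ?w0 //.
  by apply: ieexprIn; rewrite ?pinv_gt0 // lt_eqF ?pinv_lt1.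
have c0 : 0 < abs (q ^+ (p ^ v) - 1) by rewrite abs_gt0 subr_eq0.
have [N2 h2] := cvg_qpow_nat q1 hb (cvg_rate hw) c0.
have := h2 _ (leq_maxr N1 N2); have Nk := leq_maxl N1 N2.
rewrite qb; set k := maxn _ _ in Nk *.
have [m' cop ->] := pfactor_coprime p_prime (w0 k Nk).
rewrite (logE k Nk) mulnC exprM; set y := q ^+ (p ^ v).
have y1 : abs (y - 1) < 1 := qX_lt1 _ q1.
(* The geometric sum is congruent to the unit m' modulo y - 1. *)
rewrite expr_sub1 pabsM; suff -> : abs (\sum_(i < m') y ^+ i) = 1 by rewrite mulr1 ltxx.
rewrite -(@abs_nat_unit m') -?prime_coprime //; apply: abs_near.
rewrite (@abs_nat_unit m') -?prime_coprime //; apply: le_lt_trans (y1).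
have -> : m'%:R = \sum_(i < m') (1 : Omega) by rewrite sumr_const card_ord.
rewrite -sumrB; apply: abs_sum; rewrite ?pabs_ge0 // => i _.
exact: abs_qX_sub1 (theta_of_lt1 y1) (theta_of_q y) i.
Qed.

End PadicIntegers.

(** * Wilson's theorem over p consecutive integers *)

Section Wilson.
Variable p : nat.
Hypothesis p_prime : prime p.

(** The residue of the product does not depend on where the window starts, so it is that of (p -
    1)!. *)
Lemma Wilson_window m :
  (p %| (\prod_(m <= e < m + p | ~~ (p %| e)%N) e).+1)%N.
Proof.
have p_gt0 := prime_gt0 p_prime.
have charF : p \in [pchar 'F_p] by exact: pchar_Fp.
have dvdE k : (k%:R == 0 :> 'F_p) = (p %| k)%N by rewrite (dvdn_pcharf charF).
(* Multiples of p count as 1, so every [f e] is a unit and can be cancelled when the window moves by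
   one. *)
pose f e : 'F_p := if (p %| e)%N then 1 else e%:R.
have f0 e : f e != 0 by rewrite /f; case: ifP => h; rewrite ?oner_eq0 // dvdE h.
have fp e : f (e + p)%N = f e.
  by rewrite /f dvdn_addl ?dvdnn // natrD (eqP (_ : p%:R == 0)) ?addr0 ?dvdE.
have prodE a b : (\prod_(a <= e < b | ~~ (p %| e)%N) e)%:R = \prod_(a <= e < b) f e :> 'F_p.
  rewrite natr_prod big_mkcond; apply: eq_bigr => e _.
  by rewrite /f; case: (p %| e)%N.
rewrite -dvdE -natr1 prodE.
have -> : \prod_(m <= e < m + p) f e = \prod_(0 <= e < p) f e.
  elim: m => [|m IH]; first by rewrite add0n.
  rewrite -IH; apply: (mulIf (f0 m)); rewrite -{2}(fp m) mulrC -big_ltn; last by lia.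
  by rewrite -big_nat_recr //= ; lia.
rewrite big_ltn // {1}/f dvdn0 mul1r -prodE natr1 dvdE.
rewrite big_nat_cond (eq_bigl (fun e => (1 <= e < p)%N && true)) => [|e]; last first.
  rewrite andbT; apply/andP/idP => [[]//|h]; split => //.
  by apply/negP => /dvdn_leq; move/andP: h => [? ?]; lia.
rewrite -big_nat_cond; have := Wilson (prime_gt1 p_prime); rewrite p_prime => /esym.
by rewrite fact_prod; case: p p_gt0 => // k _; rewrite succnK.
Qed.

End Wilson.

(** * Ultrametric norms on algebras over Omega, given by their upper bounds *)

Record normedAlg (R : realType) (p : nat) (Omega : completedAlgClosureQp R p) := NormedAlg {
  na_ring :> nzRingType;
  na_in : {rmorphism Omega -> na_ring};
  (* [bd r x] reads: the norm of [x] is at most [r] *)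
  bd : R -> na_ring -> Prop;
  bd_in : forall r c, pabs c <= r -> bd r (na_in c);
  bdB : forall r x y, bd r x -> bd r y -> bd r (x - y);
  bdM : forall r s x y, bd r x -> bd s y -> bd (r * s) (x * y);
  bd_le : forall r s x, r <= s -> bd r x -> bd s x
}.

Section NormedAlgebras.
Variables (R : realType) (p : nat) (Omega : completedAlgClosureQp R p).
Local Notation abs := (@pabs R p Omega).

Lemma absM_le r s (x y : Omega) : abs x <= r -> abs y <= s -> abs (x * y) <= r * s.
Proof. by move=> hx hy; rewrite pabsM ler_pM ?pabs_ge0. Qed.

(** Window estimates are proved for all instances at once; this one yields the gamma function, the
    matrix instance its analogue with a matrix argument. *)
Definition base_alg : normedAlg Omega :=
  @NormedAlg R p Omega Omega idfun (fun r x => abs x <= r) (fun _ _ => id)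
    (fun _ _ _ => @absB_le _ _ _ _ _ _) absM_le (fun r s x hrs hx => le_trans hx hrs).

Definition poly_bd (r : R) (P : {poly Omega}) : Prop := 0 <= r /\ forall i, abs P`_i <= r.

Lemma poly_bd_C r c : abs c <= r -> poly_bd r c%:P.
Proof.
move=> h; have r0 := le_trans (pabs_ge0 c) h; split=> // i.
by rewrite coefC; case: ifP => _; rewrite ?abs0.
Qed.

Lemma poly_bdB r P Q : poly_bd r P -> poly_bd r Q -> poly_bd r (P - Q).
Proof. by move=> [r0 h] [_ h']; split=> // i; rewrite coefB absB_le. Qed.

Lemma poly_bdM r s P Q : poly_bd r P -> poly_bd s Q -> poly_bd (r * s) (P * Q).
Proof.
move=> [r0 h] [s0 h']; split=> [|i]; first exact: mulr_ge0.
by rewrite coefM abs_sum ?mulr_ge0 // => j _; apply: absM_le.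
Qed.

Lemma poly_bd_le r s P : r <= s -> poly_bd r P -> poly_bd s P.
Proof. by move=> rs [r0 h]; split=> [|i]; apply: le_trans rs. Qed.

(** The Gauss norm. It controls the coefficients of a product of linear factors, hence the companion
    matrices. *)
Definition poly_alg : normedAlg Omega :=
  @NormedAlg R p Omega {poly Omega} (polyC : {rmorphism Omega -> {poly Omega}})
    poly_bd poly_bd_C poly_bdB poly_bdM poly_bd_le.

Variable n : nat.

Definition mx_bd (r : R) (A : 'M[Omega]_n.+1) : Prop := forall i j, abs (A i j) <= r.

Lemma mx_bd_scalar r c : abs c <= r -> mx_bd r c%:M.
Proof.
move=> h i j; rewrite mxE; case: eqP => _; rewrite ?mulr1n // mulr0n abs0.
exact: le_trans (pabs_ge0 c) h.
Qed.

Lemma mx_bdB r A B : mx_bd r A -> mx_bd r B -> mx_bd r (A - B).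
Proof. by move=> h h' i j; rewrite !mxE absB_le. Qed.

Lemma mx_bdM r s A B : mx_bd r A -> mx_bd s B -> mx_bd (r * s) (A * B).
Proof.
move=> h h' i j; rewrite mxE abs_sum //; last by move=> k _; apply: absM_le.
by apply: mulr_ge0; [have := h i j|have := h' i j]; apply: le_trans; apply: pabs_ge0.
Qed.

Lemma mx_bd_le r s A : r <= s -> mx_bd r A -> mx_bd s A.
Proof. by move=> rs h i j; apply: le_trans rs. Qed.

(** The maximum norm on entries. The size is a successor because the ring must be nonzero. *)
Definition mx_alg : normedAlg Omega :=
  @NormedAlg R p Omega 'M[Omega]_n.+1 (scalar_mx : {rmorphism Omega -> 'M[Omega]_n.+1})
    mx_bd mx_bd_scalar mx_bdB mx_bdM mx_bd_le.

End NormedAlgebras.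

Section NormedAlgebraTheory.
Variables (R : realType) (p : nat) (Omega : completedAlgClosureQp R p).
Variable A : normedAlg Omega.
Local Notation abs := (@pabs R p Omega).
Implicit Types (r s : R) (x y z : A).

Lemma bd0 r : 0 <= r -> bd r (0 : A).
Proof. by move=> r0; rewrite -(rmorph0 (na_in A)); apply: bd_in; rewrite abs0. Qed.

Lemma bd1 : bd 1 (1 : A).
Proof. by rewrite -(rmorph1 (na_in A)); apply: bd_in; rewrite abs1. Qed.

Lemma bdN r x : 0 <= r -> bd r x -> bd r (- x).
Proof. by move=> r0 hx; rewrite -sub0r; apply: bdB => //; apply: bd0. Qed.

Lemma bdD r x y : 0 <= r -> bd r x -> bd r y -> bd r (x + y).
Proof. by move=> r0 hx hy; rewrite -[y]opprK; apply: bdB => //; apply: bdN. Qed.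

Lemma bdM1 r x y : bd r x -> bd 1 y -> bd r (x * y).
Proof. by move=> hx hy; rewrite -[r]mulr1; apply: bdM. Qed.

Lemma bd1M r x y : bd 1 x -> bd r y -> bd r (x * y).
Proof. by move=> hx hy; rewrite -[r]mul1r; apply: bdM. Qed.

Lemma bd_sum r (I : Type) (l : seq I) (P : pred I) (F : I -> A) : 0 <= r ->
  (forall i, P i -> bd r (F i)) -> bd r (\sum_(i <- l | P i) F i).
Proof.
move=> r0 h; apply: (big_ind (bd r)) => //; first exact: bd0.
by move=> *; apply: bdD.
Qed.

Lemma bd_prod1 (I : Type) (l : seq I) (P : pred I) (F : I -> A) :
  (forall i, P i -> bd 1 (F i)) -> bd 1 (\prod_(i <- l | P i) F i).
Proof.
move=> h; apply: (big_ind (bd 1)) => //; first exact: bd1.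
by move=> *; apply: bdM1.
Qed.

Lemma bdX1 x k : bd 1 x -> bd 1 (x ^+ k).
Proof. by move=> hx; elim: k => [|k IH]; [exact: bd1 | rewrite exprS; apply: bdM1]. Qed.

Lemma bd_tri r y x z : 0 <= r -> bd r (x - y) -> bd r (y - z) -> bd r (x - z).
Proof. by move=> r0 hx hy; rewrite -(subrKA y x); apply: bdD. Qed.

Lemma bd_sym r x y : 0 <= r -> bd r (x - y) -> bd r (y - x).
Proof. by move=> r0 h; rewrite -opprB; apply: bdN. Qed.

Lemma bd_congM r x y x' y' : 0 <= r -> bd 1 x -> bd 1 y' ->
  bd r (x - x') -> bd r (y - y') -> bd r (x * y - x' * y').
Proof.
move=> r0 hx hy' hxx hyy; have -> : x * y - x' * y' = x * (y - y') + (x - x') * y'.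
  by rewrite mulrBr mulrBl addrA subrK.
by apply: bdD => //; [apply: bd1M | apply: bdM1].
Qed.

Lemma bd_cong_prod r (I : Type) (l : seq I) (P : pred I) (F G : I -> A) : 0 <= r ->
  (forall i, P i -> bd 1 (F i)) -> (forall i, P i -> bd 1 (G i)) ->
  (forall i, P i -> bd r (F i - G i)) ->
  bd r (\prod_(i <- l | P i) F i - \prod_(i <- l | P i) G i).
Proof.
move=> r0 hF hG hFG; elim: l => [|i l IH]; first by rewrite !big_nil subrr; apply: bd0.
rewrite !big_cons; case: ifP => // Pi; apply: bd_congM => //; try exact: hF; try exact: hFG.
exact: bd_prod1.
Qed.

Lemma bd_congX r x y k : 0 <= r -> bd 1 x -> bd 1 y -> bd r (x - y) -> bd r (x ^+ k - y ^+ k).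
Proof.
move=> r0 hx hy h; elim: k => [|k IH]; first by rewrite subrr; apply: bd0.
by rewrite !exprS; apply: bd_congM => //; apply: bdX1.
Qed.

End NormedAlgebraTheory.

(** * Products of q-integers over windows of integers prime to p *)

Section Windows.
Variables (R : realType) (p : nat).
Hypothesis p_prime : prime p.
Variable Omega : completedAlgClosureQp R p.
Local Notation abs := (@pabs R p Omega).
Local Notation pinv := (p%:R^-1 : R).
Variable A : normedAlg Omega.
Implicit Types (q : Omega) (Z : A).
Local Notation inA := (na_in A).

(** With x = 1 + (1 - q) Z this is (1 - q^e x) / (1 - q). In terms of Z the estimates only need a
    norm at most [theta], so Z may be a matrix. *)
Definition win_factor q Z e : A := inA (qint q e) - inA (q ^+ e) * Z.

Definition win q Z m l : A := \prod_(m <= e < l | ~~ (p %| e)%N) win_factor q Z e.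

(* At Z = 0 this is Gamma_(p,q)(m); at Z = (q^(p b) - 1) / (1 - q), where the factors become
   [e + p b]_q, it is Gamma_(p,q)(p b + m) / Gamma_(p,q)(p b) when p | m. *)
Definition gwin q Z m : A := inA ((-1) ^+ m) * win q Z 0 m.

Variable theta : R.
Hypotheses (theta_ge : pinv <= theta) (theta_lt1 : theta < 1).
Let theta0 : 0 <= theta := theta_ge0 p_prime theta_ge.

Lemma qint_sum q e : q != 1 -> qint q e = \sum_(i < e) q ^+ i.
Proof.
move=> q1; rewrite /qint -opprB -[1 - q]opprB invrN mulrNN expr_sub1 mulrC mulKf //.
by rewrite subr_eq0.
Qed.

Lemma qintD q e m : q != 1 -> qint q (e + m) = qint q e + q ^+ e * qint q m.
Proof.
move=> q1; rewrite /qint mulrA -mulrDl; congr (_ / _); rewrite exprD; ring.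
Qed.

Section OneParameter.
Variables (q : Omega) (Z : A).
Hypotheses (q_neq1 : q != 1) (q_theta : abs (q - 1) <= theta) (Z_theta : bd theta Z).
Let absq : abs q = 1 := abs_q theta_lt1 q_theta.

Lemma abs_qint e : abs (qint q e) <= 1.
Proof. by rewrite qint_sum // abs_sum // => i _; rewrite absX absq expr1n. Qed.

Lemma abs_qint_nat e : abs (qint q e - e%:R) <= theta.
Proof.
have -> : e%:R = \sum_(i < e) (1 : Omega) by rewrite sumr_const card_ord.
rewrite qint_sum // -sumrB abs_sum // => i _.
exact: le_trans (abs_qX_sub1 theta_lt1 q_theta i) q_theta.
Qed.

Lemma abs_qX_dvd m N : (p ^ N %| m)%N -> abs (q ^+ m - 1) <= abs (q - 1) * theta ^+ N.
Proof.
move=> h; rewrite -(expr0 q); apply: abs_qX_cong => //.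
by apply/eqP; rewrite mod0n.
Qed.

Lemma abs_qint_dvd m N : (p ^ N %| m)%N -> abs (qint q m) <= theta ^+ N.
Proof.
move=> /abs_qX_dvd h; rewrite /qint absf_div absBC [abs (1 - q)]absBC.
by rewrite ler_pdivrMr ?abs_gt0 ?subr_eq0 // mulrC.
Qed.

Lemma bdZ1 : bd 1 Z.
Proof. by apply: bd_le Z_theta; rewrite ltW. Qed.

Lemma bd_win_factor e : bd 1 (win_factor q Z e).
Proof.
apply: bdB; first exact: bd_in (abs_qint e).
by apply: bdM1 bdZ1; apply: bd_in; rewrite absX absq expr1n.
Qed.

Lemma bd_win m l : bd 1 (win q Z m l).
Proof. by apply: bd_prod1 => e _; apply: bd_win_factor. Qed.

Lemma bd_gwin m : bd 1 (gwin q Z m).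
Proof. by apply: bdM1 (bd_win _ _); apply: bd_in; rewrite abs_sign. Qed.

(** The difference is q^e [m]_q - q^e (q^m - 1) Z, and both [m]_q and q^m - 1 have size at most
    [theta ^+ N]. *)
Lemma win_factor_shift e m N : (p ^ N %| m)%N ->
  bd (theta ^+ N) (win_factor q Z (e + m) - win_factor q Z e).
Proof.
move=> h; have tN : 0 <= theta ^+ N by rewrite exprn_ge0.
have -> : win_factor q Z (e + m) - win_factor q Z e
    = inA (q ^+ e * qint q m) - inA (q ^+ e * (q ^+ m - 1)) * Z.
  have aux (a b x y : A) : a + b - x - (a - y) = b - (x - y).
    by rewrite !opprB !addrA addrAC [a + b]addrC [b + a - x - a]addrAC addrK addrAC.
  by rewrite /win_factor qintD // exprD mulrBr mulr1 rmorphD rmorphB mulrBl aux.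
have qe1 : abs (q ^+ e) = 1 by rewrite absX absq expr1n.
apply: bdB; first by apply: bd_in; rewrite pabsM qe1 mul1r abs_qint_dvd.
apply: bdM1 bdZ1; apply: bd_in; rewrite pabsM qe1 mul1r.
apply: le_trans (abs_qX_dvd h) _; rewrite ler_piMl //.
exact: le_trans q_theta (ltW theta_lt1).
Qed.

Lemma win_cat m l k : (m <= l <= k)%N -> win q Z m k = win q Z m l * win q Z l k.
Proof. by move=> /andP[h1 h2]; rewrite /win (@big_cat_nat _ _ _ l). Qed.

Lemma win_shift m l k N : (0 < N)%N -> (p ^ N %| k)%N ->
  bd (theta ^+ N) (win q Z (m + k) (l + k) - win q Z m l).
Proof.
(* As N > 0, the shift by k preserves the condition of being prime to p. *)
move=> N0 h; have pk : (p %| k)%N by apply: dvdn_trans h; rewrite dvdn_exp.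
rewrite /win big_addn addnK (eq_bigl (fun e => ~~ (p %| e)%N)); last first.
  by move=> e; rewrite dvdn_addl.
apply: bd_cong_prod => [|e _|e _|e _]; rewrite ?exprn_ge0 //; try exact: bd_win_factor.
exact: win_factor_shift.
Qed.

Local Notation sgn := (inA ((-1) ^+ p)).

Lemma bd_sgn : bd 1 sgn.
Proof. by apply: bd_in; rewrite abs_sign. Qed.

(** Wilson's theorem yields -1, whereas the windows tend to (-1)^p. The two differ only for p = 2,
    and then by p. *)
Lemma abs_sgn1 : abs ((-1) ^+ p + 1) <= theta.
Proof.
apply: le_trans theta_ge; case: (even_prime p_prime) => [p2|po].
  have aux k : k = 2%N -> (-1) ^+ k + 1 = k%:R :> Omega by move=> ->; rewrite sqrrN expr1n.
  by rewrite aux // pabs_p.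
by rewrite -signr_odd po expr1 addrC subrr abs0 ltW ?pinv_gt0.
Qed.

(** Up to [theta], [e]_q is e and Z is 0, so the window is the integer product [P], congruent to -1
    by Wilson's theorem. *)
Lemma win_base m : bd theta (win q Z m (m + p) - sgn).
Proof.
pose P := (\prod_(m <= e < m + p | ~~ (p %| e)%N) e)%N.
apply: (@bd_tri _ _ _ _ _ (inA P%:R)) => //.
  rewrite natr_prod rmorph_prod; apply: bd_cong_prod => // [e _|e _|e _].
  - exact: bd_win_factor.
  - by apply: bd_in; apply: abs_nat_le1.
  rewrite /win_factor addrAC -rmorphB; apply: bdB.
    by apply: bd_in; apply: abs_qint_nat.
  by apply: bd1M => //; apply: bd_in; rewrite absX absq expr1n.
rewrite -rmorphB; apply: bd_in; rewrite -(addrKA 1).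
apply: absB_le; last by rewrite addrC abs_sgn1.
by apply: le_trans theta_ge; rewrite natr1 -(expr1 pinv) abs_nat_le_exp ?expn1 // Wilson_window.
Qed.

(** With s = [sgn] and s^p = s, x^p - s is x - s times the sum of the x^(p-1-i) s^i. Up to [r] that
    sum is p s^(p-1), so its norm is at most [theta]. *)
Lemma bd_pow_sgn r x : 0 <= r <= theta -> bd r (x - sgn) -> bd (theta * r) (x ^+ p - sgn).
Proof.
move=> /andP[r0 rt] hx.
have sp : sgn ^+ p = sgn.
  by rewrite -rmorphXn -exprM -[X in inA X = _]signr_odd oddM andbb signr_odd.
have x1 : bd 1 x.
  rewrite -(subrK sgn x); apply: bdD => //; last exact: bd_sgn.
  by apply: bd_le hx; apply: le_trans rt _; apply: ltW.
have comm : GRing.comm x sgn.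
  by rewrite rmorphXn rmorphN1; apply: commrX; apply: commrN1.
rewrite -[X in _ - X]sp subrXX_comm // [theta * r]mulrC; apply: bdM => //.
have -> : \sum_(i < p) x ^+ (p.-1 - i) * sgn ^+ i =
   \sum_(i < p) (x ^+ (p.-1 - i) - sgn ^+ (p.-1 - i)) * sgn ^+ i + inA (p%:R * ((-1) ^+ p) ^+ p.-1).
  have -> z : inA (p%:R * z) = \sum_(i < p) inA z.
    by rewrite sumr_const card_ord rmorphM rmorph_nat mulr_natl.
  rewrite -big_split /=; apply: eq_bigr => i _; rewrite mulrBl -exprD subnK.
    by rewrite [inA (_ ^+ p.-1)]rmorphXn /= subrK.
  by rewrite -ltnS prednK ?prime_gt0.
apply: bdD => //.
  apply: bd_sum => // i _; apply: bdM1; last by apply: bdX1; apply: bd_sgn.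
  by apply: bd_congX => //; [exact: bd_sgn | apply: bd_le hx].
by apply: bd_in; rewrite pabsM -exprM abs_sign mulr1 pabs_p.
Qed.

(** A window of length p^(N+1) splits into p windows of length p^N, each within [theta ^+ N] of the
    first. It is thus close to the p-th power of the first, to which [bd_pow_sgn] applies. *)
Lemma win_step N m r : (0 < N)%N -> 0 <= r <= theta ->
  bd r (win q Z m (m + p ^ N) - sgn) ->
  bd (Num.max (theta ^+ N) (theta * r)) (win q Z m (m + p ^ N.+1) - sgn).
Proof.
move=> N0 rt h; have tN : 0 <= theta ^+ N by rewrite exprn_ge0.
apply: (@bd_tri _ _ _ _ _ (win q Z m (m + p ^ N) ^+ p)); first by rewrite le_max tN.
  apply: (@bd_le _ _ _ _ (theta ^+ N)); first by rewrite le_max lexx.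
  rewrite expnS; set W := win q Z m (m + p ^ N).
  suff H k : bd (theta ^+ N) (win q Z m (m + k * p ^ N) - W ^+ k) by exact: H.
  elim: k => [|k IH].
    by rewrite mul0n addn0 expr0 /win big_geq // subrr; apply: bd0.
  rewrite (@win_cat _ (m + k * p ^ N)); last by rewrite mulSn; lia.
  rewrite exprSr; apply: bd_congM => //; try exact: bd_win.
  rewrite mulSn addnA; apply: win_shift => //; exact: dvdn_mull.
apply: bd_le (bd_pow_sgn rt h); by rewrite le_max lexx orbT.
Qed.

Lemma win_sgn N m : bd (theta ^+ N) (win q Z m (m + p ^ N.+1) - sgn).
Proof.
(* The bound [theta] is carried along because at N = 0 the rate [theta ^+ N] is 1, too weak for
   [win_step]. *)
suff [] : bd theta (win q Z m (m + p ^ N.+1) - sgn) /\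
    bd (theta ^+ N) (win q Z m (m + p ^ N.+1) - sgn) by [].
elim: N => [|N [IH1 IH2]].
  by rewrite expn1 expr0; split; [|apply: bd_le (ltW theta_lt1) _]; apply: win_base.
have tle k : theta ^+ k.+1 <= theta.
  by rewrite -{2}(expr1 theta) ler_wiXn2l // ltW.
have t01 : 0 <= theta <= theta by rewrite theta0 lexx.
suff h : bd (theta ^+ N.+1) (win q Z m (m + p ^ N.+2) - sgn).
  by split=> //; apply: bd_le h.
case: N IH1 IH2 => [|N] IH1 IH2.
  apply: bd_le (win_step (ltn0Sn 0) t01 IH1).
  by rewrite expr1 ge_max lexx ler_piMr // ltW.
apply: bd_le (win_step (ltn0Sn _) _ IH2); last by rewrite exprn_ge0 //=.
by rewrite -exprS maxxx.
Qed.

(** Lengthening by p^(N+1) multiplies the value by the sign (-1)^(p^(N+1)) = (-1)^p and by a window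
    close to (-1)^p, hence by an element within [theta ^+ N] of 1. *)
Lemma gwin_cong m l N : m = l %[mod p ^ N.+1]%N ->
  bd (theta ^+ N) (gwin q Z m - gwin q Z l).
Proof.
have tN : 0 <= theta ^+ N by rewrite exprn_ge0.
wlog h : m l / (l <= m)%N => [H|] e.
  by case/orP: (leq_total l m) => h; [exact: H | apply: bd_sym => //; apply: H].
have /dvdnP[k kE] : (p ^ N.+1 %| m - l)%N by rewrite -eqn_mod_dvd // e.
rewrite -(subnK h) kE addnC; elim: k {e h kE m} => [|k IH].
  by rewrite addn0 subrr; apply: bd0.
apply: (@bd_tri _ _ _ _ _ (gwin q Z (l + k * p ^ N.+1))) => //.
set m := (l + k * p ^ N.+1)%N; have -> : (l + k.+1 * p ^ N.+1 = m + p ^ N.+1)%N.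
  by rewrite /m mulSn addnA addnAC.
rewrite /gwin (@win_cat 0 m) ?leq_addr // exprD rmorphM -[win q Z 0 m in X in _ - X]mulr1.
rewrite mulrA; set s := inA _; set W := win q Z 0 m.
have -> : s * inA ((-1) ^+ (p ^ N.+1)) * W * win q Z m (m + p ^ N.+1) - s * (W * 1)
   = s * (W * (inA ((-1) ^+ (p ^ N.+1)) * win q Z m (m + p ^ N.+1) - 1)).
  rewrite rmorphXn rmorphN1 -signr_odd; case: odd; rewrite ?expr0 ?expr1 ?mul1r ?mulr1 ?mulN1r.
    by rewrite mulrN1 !mulNr !mulrBr !mulrN mulr1 mulrA.
  by rewrite !mulrBr mulr1 mulrA.
apply: bd1M; first by apply: bd_in; rewrite abs_sign.
apply: bd1M; first exact: bd_win.
have -> : inA ((-1) ^+ (p ^ N.+1)) = sgn.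
  by rewrite -signr_odd oddX /= signr_odd.
have <- : sgn * sgn = 1 by rewrite -rmorphM -exprD -signr_odd addnn odd_double rmorph1.
rewrite -mulrBr; apply: bd1M; [exact: bd_sgn | exact: win_sgn].
Qed.

End OneParameter.

(** The factors are bounded by 1 and each moves by at most [r], so the bound is uniform in the
    length [m]. *)
Lemma gwin_lip q q' Z Z' m r : q != 1 -> q' != 1 -> abs (q - 1) <= theta ->
  abs (q' - 1) <= theta -> bd theta Z -> bd theta Z' -> 0 <= r ->
  abs (q - q') <= r -> bd r (Z - Z') -> bd r (gwin q Z m - gwin q' Z' m).
Proof.
move=> q1 q1' qt qt' Zt Zt' r0 qq ZZ.
have qe e : abs (q ^+ e - q' ^+ e) <= r.
  by apply: abs_exprB => //; rewrite (abs_q theta_lt1).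
rewrite /gwin -mulrBr; apply: bd1M; first by apply: bd_in; rewrite abs_sign.
apply: bd_cong_prod => // e _; try exact: bd_win_factor.
rewrite /win_factor opprD addrACA -opprD -rmorphB; apply: bdB.
  by apply: bd_in; rewrite !qint_sum // -sumrB abs_sum.
apply: bd_congM => //; last 1 first.
- by rewrite -rmorphB; apply: bd_in.
- by apply: bd_in; rewrite absX (abs_q theta_lt1 qt) expr1n.
- exact: bdZ1.
Qed.

End Windows.

(** * Koblitz's p-adic q-gamma function *)

Section QGamma.
Variables (R : realType) (p : nat).
Hypothesis p_prime : prime p.
Variable Omega : completedAlgClosureQp R p.
Local Notation abs := (@pabs R p Omega).
Local Notation cvg := (cvg_seq_to abs).
Local Notation pinv := (p%:R^-1 : R).
Variable q : Omega.
Hypothesis hq : 0 < abs (q - 1) < 1.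
Local Notation theta := (theta_of q).

Let q_lt1 : abs (q - 1) < 1. Proof. by case/andP: hq. Qed.
Let q_neq1 : q != 1. Proof. by rewrite -subr_eq0 -abs_gt0; case/andP: hq. Qed.
Let t_ge : pinv <= theta := theta_of_ge q.
Let t_lt1 : theta < 1 := theta_of_lt1 p_prime q_lt1.
Let q_t : abs (q - 1) <= theta := theta_of_q q.
Let t_ge0 : 0 <= theta := theta_ge0 p_prime t_ge.

Lemma gwin0 m : gwin (A := base_alg Omega) q 0 m = qgamma_nat q m.
Proof.
rewrite /gwin /qgamma_nat; congr (_ * _); rewrite /win.
have E e : win_factor (A := base_alg Omega) q 0 e = qint q e by rewrite /win_factor mulr0 subr0.
rewrite (eq_bigr _ (fun e _ => E e)); case: m => [|m]; first by rewrite !big_geq.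
by rewrite big_mkcond big_ltn //= dvdn0 mul1r -big_mkcond.
Qed.

Lemma qgamma_nat_cong m l N : m = l %[mod p ^ N.+1]%N ->
  abs (qgamma_nat q m - qgamma_nat q l) <= theta ^+ N.
Proof.
move=> h; rewrite -!gwin0.
exact: (@gwin_cong _ _ p_prime _ (base_alg Omega) _ t_ge t_lt1 _ _ q_neq1 q_t (bd0 _ t_ge0) _ _ _ h).
Qed.

Lemma abs_qint_unit e : ~~ (p %| e)%N -> abs (qint q e) = 1.
Proof.
move=> pe; rewrite -(abs_nat_unit p_prime Omega pe); apply: abs_near.
by rewrite abs_nat_unit //; apply: le_lt_trans t_lt1; exact: (abs_qint_nat p_prime t_ge).
Qed.

Lemma abs_qgamma_nat m : abs (qgamma_nat q m) = 1.
Proof.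
by rewrite pabsM abs_sign mul1r abs_prod big1 // => e; apply: abs_qint_unit.
Qed.

(** Along natural approximations of x the values are Cauchy by [qgamma_nat_cong]. The stated rate
    contains both continuity and interpolation at natural numbers. *)
Lemma qgamma_exists : exists G : Omega -> Omega, forall x, in_Zp x ->
  forall N (m : nat), abs (x - m%:R) <= pinv ^+ N.+1 -> abs (G x - qgamma_nat q m) <= theta ^+ N.
Proof.
suff H x : exists y : Omega, in_Zp x -> forall N (m : nat),
    abs (x - m%:R) <= pinv ^+ N.+1 -> abs (y - qgamma_nat q m) <= theta ^+ N.
  by have [G hG] := choice H; exists G.
have [hx|nx] := pselect (in_Zp x); last by exists 0.
have [w hw] := Zp_seq p_prime hx.
have wc k l (m : nat) : (k <= l)%N -> abs (x - m%:R) <= pinv ^+ k -> w l = m %[mod p ^ k]%N.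
  move=> kl hm; apply/eqP; rewrite -(abs_natB_le_exp p_prime Omega).
  apply: (@abs_tri_le _ _ _ _ x) => //; rewrite absBC; apply: le_trans (hw l) _.
  by rewrite ler_wiXn2l // ltW ?pinv_gt0 ?pinv_lt1.
have [|k l kl|y _ hy] := @cauchy_rate _ _ _ (fun k => qgamma_nat q (w k.+1)) (fun k => theta ^+ k).
- by move=> e; apply: expr_lt_eps; rewrite t_ge0.
- by apply: qgamma_nat_cong; apply: wc.
exists y => _ N m hm; apply: abs_tri_le (hy N) _.
by apply: qgamma_nat_cong; apply: wc.
Qed.

Lemma qgammaP : continuous_on_Zp (qgamma q) /\ forall m : nat, qgamma q m%:R = qgamma_nat q m.
Proof.
have [G hG] := qgamma_exists.
(* A function selected by [xget] has both properties, so it remains to verify them for the witness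
   [G]. *)
rewrite /qgamma; case: xgetP => [g _ //|/(_ G)[]]; split.
  move=> x hx e e0.
  have [N hN] := expr_lt_eps (t := theta) ltac:(by rewrite t_ge0) e0.
  exists (pinv ^+ N.+1) => [|y hy yx]; first by rewrite exprn_gt0 ?pinv_gt0.
  have [m hm] := (in_ZpP p_prime _).1 hx N.+1.
  apply: le_lt_trans (hN N (leqnn N)); apply: (@abs_tri_le _ _ _ _ (qgamma_nat q m)).
    by apply: hG => //; apply: abs_tri_le hm; apply: ltW.
  by rewrite absBC; apply: hG.
move=> m; apply/eqP; rewrite -subr_eq0; apply/eqP/small_abs_eq0 => e e0.
have [N hN] := expr_lt_eps (t := theta) ltac:(by rewrite t_ge0) e0.
apply: ltW; apply: le_lt_trans (hN N (leqnn N)); apply: hG; first exact: in_Zp_nat.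
by rewrite subrr abs0 exprn_ge0 // ltW ?pinv_gt0.
Qed.

Lemma cvg_qgamma (u : nat -> Omega) x : (forall k, in_Zp (u k)) -> in_Zp x -> cvg u x ->
  cvg (fun k => qgamma q (u k)) (qgamma q x).
Proof.
move=> hu hx h e e0; have [d d0 hd] := qgammaP.1 x hx e e0.
by have [N hN] := h d d0; exists N => k /hN; apply: hd.
Qed.

Lemma qgamma_lip x y N : in_Zp x -> in_Zp y -> abs (x - y) <= pinv ^+ N.+1 ->
  abs (qgamma q x - qgamma q y) <= theta ^+ N.
Proof.
move=> hx hy xy; have [[w hw] [w' hw']] := (Zp_seq p_prime hx, Zp_seq p_prime hy).
have c1 := cvg_qgamma (fun k => in_Zp_nat p_prime Omega (w k)) hx (cvg_rate p_prime hw).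
have c2 := cvg_qgamma (fun k => in_Zp_nat p_prime Omega (w' k)) hy (cvg_rate p_prime hw').
apply: (cvg_abs_le (cvgB c1 c2)); exists N.+1 => k Nk.
by rewrite !qgammaP.2; apply: qgamma_nat_cong; apply: Zp_seq_cong Nk.
Qed.

Lemma abs_qgamma x : in_Zp x -> abs (qgamma q x) = 1.
Proof.
move=> hx; have [N hN] := expr_lt_eps (t := theta) ltac:(by rewrite t_ge0) (@ltr01 R).
have [m hm] := (in_ZpP p_prime _).1 hx N.+1.
rewrite -(abs_qgamma_nat m) -qgammaP.2; apply: abs_near; rewrite {2}qgammaP.2 abs_qgamma_nat.
by apply: le_lt_trans (hN N _) => //; apply: qgamma_lip => //; apply: in_Zp_nat.
Qed.

Lemma qgamma_neq0 x : in_Zp x -> qgamma q x != 0.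
Proof. by move=> hx; rewrite -abs_neq0 abs_qgamma // oner_eq0. Qed.

(** * The middle ratio of the Phi's as a quotient of gamma values *)

Lemma one_sub_qX_neq0 e : ~~ (p %| e)%N -> 1 - q ^+ e != 0.
Proof.
move=> /abs_qint_unit h; apply/negP => /eqP h0; move/eqP: h.
by rewrite /qint h0 mul0r abs0 eq_sym oner_eq0.
Qed.

Definition cyclo k : Omega := \prod_(0 <= e < p * k | ~~ (p %| e)%N) (1 - q ^+ e).

Lemma cyclo_neq0 k : cyclo k != 0.
Proof. by rewrite /cyclo prodf_seq_neq0; apply/allP => e _; apply/implyP => /one_sub_qX_neq0. Qed.

Lemma prod_const_coprime (c : Omega) k :
  \prod_(0 <= e < p * k | ~~ (p %| e)%N) c = (\prod_(0 <= e < p | ~~ (p %| e)%N) c) ^+ k.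
Proof.
elim: k => [|k IH]; first by rewrite muln0 big_geq.
rewrite (@big_cat_nat _ _ _ (p * k)) ?leq_mul //= IH exprSr; congr (_ * _).
rewrite mulnS -{1}[(p * k)%N]add0n big_addn addnK; apply: eq_bigl => e.
by rewrite dvdn_addl ?dvdn_mulr.
Qed.

(** Each block of p consecutive integers contributes the same sign and the same power of 1 - q. The
    normalization is therefore exponential in k and cancels from the middle ratio. *)
Lemma qgamma_nat_cyclo : exists2 c : Omega, c != 0 & forall k, qgamma_nat q (p * k) = cyclo k * c ^+ k.
Proof.
exists ((-1) ^+ p * \prod_(0 <= e < p | ~~ (p %| e)%N) (1 - q)^-1) => [|k].
  rewrite mulf_neq0 ?signr_eq0 //; rewrite prodf_seq_neq0; apply/allP => e _.
  by apply/implyP => _; rewrite invr_eq0 subr_eq0 eq_sym.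
rewrite exprMn -exprM -prod_const_coprime mulrCA -big_split /= -gwin0 /gwin; congr (_ * _).
by apply: eq_bigr => e _; rewrite /win_factor mulr0 subr0.
Qed.

Lemma pochinf_multE s e : (p %| s)%N -> pochinf_mult s p e = Posz ((s <= e)%N && (p %| e)%N).
Proof.
by move=> ps; rewrite /pochinf_mult; congr (Posz (nat_of_bool _)); case: leqP => // h; rewrite dvdn_subl.
Qed.

(** For p | e the q-products and the q^p-products contribute equally. Otherwise the q^p-products do
    not contain 1 - q^e, and e differs from p m, so that p m + 1 <= e amounts to p m <= e. *)
Lemma phi_ratio_multE m h e : phi_ratio_mult p m h e =
  if (p %| e)%N then 0 else Posz (e < p * (m + h))%N - Posz (e < p * h)%N - Posz (e < p * m)%N.
Proof.
have p0 := prime_gt0 p_prime.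
rewrite /phi_ratio_mult !pochinf_multE ?dvdn_add ?dvdn_mulr //.
rewrite /pochinf_mult !dvd1n !andbT -mulnDr; case: ifP => [/dvdnP[k ->]|pe].
  rewrite !andbT -[(p * m + p)%N]/(p * m + p)%N.
  have -> : (p * m + 1 <= k * p)%N = (m < k)%N by rewrite addn1 mulnC ltn_pmul2r.
  have -> : (p * m + p <= k * p)%N = (m < k)%N by rewrite -mulnSr mulnC leq_pmul2r.
  have -> : (p <= k * p)%N = (1 <= k * p)%N by case: k => [|k]; rewrite ?mul0n ?mulSn; lia.
  by lia.
rewrite !andbF.
have e0 : (0 < e)%N by case: e pe => //; rewrite dvdn0.
have em k : e != (p * k)%N by apply/negP => /eqP E; rewrite E dvdn_mulr in pe.
have := em m; lia.
Qed.

Lemma phi_ratio_natE m h : phi_ratio_nat q m h = cyclo (m + h) / (cyclo m * cyclo h).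
Proof.
pose L := (p * (m + h + 1))%N.
have cE k : (k <= m + h)%N -> cyclo k = \prod_(0 <= e < L | ~~ (p %| e)%N) (1 - q ^+ e) ^+ (e < p * k)%N.
  move=> kmh; rewrite /cyclo (@big_nat_widen _ _ _ _ _ L); last by rewrite leq_mul // addn1 ltnW.
  rewrite big_mkcondr; apply: eq_bigr => e _; by case: ifP.
rewrite invfM mulrA !cE ?leq_addr ?leq_addl // -!prodfV -!big_split /=.
rewrite /phi_ratio_nat -(big_mkord xpredT (fun e => (1 - q ^+ e) ^ phi_ratio_mult p m h e)) [RHS]big_mkcond /=.
apply: eq_bigr => e _; rewrite phi_ratio_multE; case: ifP => //= /negbT pe.
have u0 := one_sub_qX_neq0 pe; by rewrite !expfzDr // -!invr_expz -!exprnP mulrAC.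
Qed.

Lemma phi_ratio_nat_gamma m h : phi_ratio_nat q m h =
  qgamma_nat q (p * (m + h)) / (qgamma_nat q (p * m) * qgamma_nat q (p * h)).
Proof.
have [c c0 cE] := qgamma_nat_cyclo; rewrite phi_ratio_natE !cE exprD.
by field; rewrite !expf_neq0 //= !cyclo_neq0.
Qed.

Definition gamma_ratio x y : Omega :=
  qgamma q (p%:R * (x + y)) / (qgamma q (p%:R * x) * qgamma q (p%:R * y)).

Lemma in_Zp_pM (x : Omega) : in_Zp x -> in_Zp (p%:R * x).
Proof. by move=> h; apply: (in_ZpM p_prime) h; apply: in_Zp_nat. Qed.

Lemma cvg_gamma_ratio (u v : nat -> Omega) x y : (forall k, in_Zp (u k)) -> in_Zp x ->
  (forall k, in_Zp (v k)) -> in_Zp y -> cvg u x -> cvg v y ->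
  cvg (fun k => gamma_ratio (u k) (v k)) (gamma_ratio x y).
Proof.
move=> hu hx hv hy cu cv; have G (w : nat -> Omega) z : (forall k, in_Zp (w k)) -> in_Zp z -> cvg w z ->
    cvg (fun k => qgamma q (p%:R * w k)) (qgamma q (p%:R * z)).
  move=> hw hz cw; apply: cvg_qgamma => [k||]; try exact: in_Zp_pM.
  by apply: cvgM => //; apply: cvg_cst.
apply: cvg_div.
- by apply: G; [move=> k; apply: (in_ZpD p_prime) | apply: (in_ZpD p_prime) | apply: cvgD].
- by apply: cvgM; apply: G.
- by rewrite mulf_neq0 // qgamma_neq0 //; apply: in_Zp_pM.
Qed.

Lemma gamma_ratio_nat m h : gamma_ratio m%:R h%:R = phi_ratio_nat q m h.
Proof. by rewrite /gamma_ratio -natrD -!natrM !qgammaP.2 phi_ratio_nat_gamma. Qed.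

Lemma abs_invB (x y : Omega) r : abs x = 1 -> abs y = 1 -> abs (x - y) <= r -> abs (x^-1 - y^-1) <= r.
Proof.
move=> x1 y1 h; have x0 : x != 0 by rewrite -abs_neq0 x1 oner_eq0.
have y0 : y != 0 by rewrite -abs_neq0 y1 oner_eq0.
have -> : x^-1 - y^-1 = (y - x) / (x * y) by field; rewrite x0 y0.
by rewrite absf_div pabsM x1 y1 mulr1 divr1 absBC.
Qed.

Lemma gamma_ratio_lip x y x' y' N : in_Zp x -> in_Zp y -> in_Zp x' -> in_Zp y' ->
  abs (x' - x) <= pinv ^+ N.+1 -> abs (y' - y) <= pinv ^+ N.+1 ->
  abs (gamma_ratio x' y' - gamma_ratio x y) <= theta ^+ N.
Proof.
move=> hx hy hx' hy' dx dy.
have tN : 0 <= theta ^+ N by rewrite exprn_ge0.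
have G z z' : in_Zp z -> in_Zp z' -> abs (z' - z) <= pinv ^+ N.+1 ->
    abs (qgamma q (p%:R * z') - qgamma q (p%:R * z)) <= theta ^+ N.
  move=> hz hz' d; apply: qgamma_lip; try exact: in_Zp_pM.
  rewrite -mulrBr pabsM; apply: le_trans d; rewrite ler_piMl ?pabs_ge0 //.
  exact: abs_nat_le1.
have G1 z : in_Zp z -> abs (qgamma q (p%:R * z)) = 1 by move=> hz; rewrite abs_qgamma //; apply: in_Zp_pM.
have hxy := in_ZpD p_prime hx hy; have hxy' := in_ZpD p_prime hx' hy'.
have cong := @bd_congM _ _ _ (base_alg Omega); rewrite /= in cong.
apply: (cong) => //.
- by rewrite G1.
- by rewrite absV pabsM !G1 // mulr1 invr1.
- by apply: G => //; rewrite opprD addrACA; apply: absD_le.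
apply: abs_invB; rewrite ?pabsM ?G1 ?mulr1 //.
by apply: (cong) => //; rewrite ?G1 //; apply: G.
Qed.

(** Pairs of natural numbers are dense in Z_p x Z_p, so a continuous extension is unique;
    [gamma_ratio] shows that one exists. *)
Lemma phi_ratioE x y : in_Zp x -> in_Zp y -> phi_ratio q x y = gamma_ratio x y.
Proof.
move=> hx hy; rewrite /phi_ratio; case: xgetP => [G _ [cG nG]|/(_ gamma_ratio)[]]; last first.
  split; last exact: gamma_ratio_nat.
  move=> x1 y1 hx1 hy1 e e0.
  have [N hN] := expr_lt_eps (t := theta) ltac:(by rewrite t_ge0) e0.
  exists (pinv ^+ N.+1) => [|x2 y2 hx2 hy2 dx dy]; first by rewrite exprn_gt0 ?pinv_gt0.
  by apply: le_lt_trans (hN N _) => //; apply: gamma_ratio_lip => //; apply: ltW.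
have [[w hw] [w' hw']] := (Zp_seq p_prime hx, Zp_seq p_prime hy).
have nZ := in_Zp_nat p_prime Omega.
apply: (@cvg_unique _ _ _ (fun k => gamma_ratio (w k)%:R (w' k)%:R)); last first.
  by apply: cvg_gamma_ratio => //; apply: (cvg_rate p_prime).
move=> e /(cG x y hx hy)[d d0 hd].
have [N hN] := cvg_rate p_prime hw d0; have [M hM] := cvg_rate p_prime hw' d0.
exists (maxn N M) => k; rewrite geq_max => /andP[/hN h1 /hM h2].
by rewrite gamma_ratio_nat -nG; apply: hd.
Qed.

(** At this argument the factors are [e + p b]_q, so the window is the plain one from p b to p b + p
    m, and plain windows concatenate. *)
Lemma gwin_gamma_nat b m :
  gwin (A := base_alg Omega) q ((q ^+ (p * b) - 1) / (1 - q)) (p * m) * qgamma_nat q (p * b)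
  = qgamma_nat q (p * (b + m)).
Proof.
have aux (x y z t : Omega) : x * y * (z * t) = z * x * (t * y) by ring.
rewrite -!gwin0 /gwin mulnDr exprD (@win_cat _ _ _ _ _ 0 0 (p * b) (p * b + p * m)) /= ?leq_addr //.
have W : win (A := base_alg Omega) q ((q ^+ (p * b) - 1) / (1 - q)) 0 (p * m)
    = win (A := base_alg Omega) q 0 (p * b) (p * b + p * m); last by apply: etrans (aux _ _ _ _) _; congr (_ * (_ * _)).
rewrite /win -[X in _ = \prod_(X <= _ < _ | _) _]add0n big_addn addKn.
apply: eq_big => [e|e _]; first by rewrite dvdn_addl ?dvdn_mulr.
by rewrite /win_factor mulr0 subr0 /= qintD // /qint; field; rewrite subr_eq0 eq_sym.
Qed.

(** Both sides are continuous in b, so the case of natural b suffices. [m] stays natural because the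
    left side is a finite product. *)
Lemma gwin_gamma b m : in_Zp b ->
  gwin (A := base_alg Omega) q ((qpow q (p%:R * b) - 1) / (1 - q)) (p * m) * qgamma q (p%:R * b)
  = qgamma q (p%:R * (b + m%:R)).
Proof.
move=> hb; have [w hw] := Zp_seq p_prime hb; have cw := cvg_rate p_prime hw.
have nZ := in_Zp_nat p_prime Omega.
apply: (@cvg_unique _ _ _ (fun k => qgamma_nat q (p * (w k + m)))); last first.
  apply: cvg_ext (cvg_qgamma (u := fun k => p%:R * ((w k)%:R + m%:R)) _ _ _) => [k|k||].
  - by rewrite -natrD -natrM qgammaP.2.
  - by rewrite -natrD; apply: in_Zp_pM.
  - by apply: in_Zp_pM; apply: in_ZpD.
  - by apply: cvgM; [apply: cvg_cst | apply: cvgD => //; apply: cvg_cst].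
have pw : cvg (fun k => p%:R * (w k)%:R) (p%:R * b) by apply: cvgM => //; apply: cvg_cst.
apply: cvg_ext (cvgM _ _) => [k||]; first by rewrite -gwin_gamma_nat.
  apply: cvgM; first exact: cvg_cst.
  apply: cvg_prod => e _; apply: cvgB; first exact: cvg_cst.
  apply: cvgM; first exact: cvg_cst.
  apply: cvgM; last exact: cvg_cst; apply: cvgB; last exact: cvg_cst.
  apply: (cvg_qpow_nat p_prime) => //; first exact: in_Zp_pM.
  by apply: cvg_ext pw => k; rewrite natrM.
apply: cvg_ext (cvg_qgamma (u := fun k => p%:R * (w k)%:R) _ _ pw) => [k|k|].
- by rewrite -natrM qgammaP.2.
- exact: in_Zp_pM.
- exact: in_Zp_pM.
Qed.

End QGamma.

(** * The constant term at generic parameters *)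

Section GenericConstantTerm.
Variables (R : realType) (p : nat).
Hypothesis p_prime : prime p.
Variable Omega : completedAlgClosureQp R p.
Local Notation abs := (@pabs R p Omega).
Variable n : nat.
Implicit Types (h q : Omega) (a x y : 'I_n -> Omega).

Definition node a q : 'I_n -> Omega := fun j => qpow q (p%:R * a j).

Definition vander x : 'M[Omega]_n := \matrix_(i, j) x j ^+ i.

Definition eig_mx h a q : 'M[Omega]_n := diag_mx (\row_j U0_eigenvalue h a q j).

Lemma Psi'_0 h a q : Psi' h a q 0%N = \matrix_(i, j) qpow q (i%:R * a j).
Proof.
apply/matrixP => i j; rewrite !mxE expr0 mulr1 /f_coef big1 ?mulr1 // => k _.
by rewrite /qpoch !big_ord0 divr1.
Qed.

Lemma fixed_ptE h a q i : admissible h a q -> fixed_pt a q i = col i (vander (node a q)).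
Proof.
case=> _ ha /andP[_ q1]; apply/colP => k; rewrite !mxE (qpow_natM p_prime) //.
exact: in_Zp_pM.
Qed.

Lemma Phi_ratio_diagE h a q : admissible h a q -> Phi_ratio_diag h a q = eig_mx h a q.
Proof.
case=> hh ha hq; congr diag_mx; apply/rowP => j; rewrite !mxE; apply: eq_bigr => k _.
by rewrite phi_ratioE //; apply: (in_ZpB p_prime).
Qed.

Lemma Psi'_frob0 h a q : admissible h a q -> Psi' h a (q ^+ p) 0%N = vander (node a q).
Proof.
case=> hh ha /andP[_ q1]; rewrite Psi'_0; apply/matrixP => i j; rewrite !mxE.
by rewrite (qpow_natM p_prime) ?(qX_lt1 p_prime) // (qpow_expl p_prime).
Qed.

(** Only the constant coefficients of the three factors enter. As (q^p)^b = q^(p b), both matrices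
    [Psi'] have the same one, the Vandermonde matrix of the nodes. *)
Lemma U_generic0 h a q : admissible h a q -> U_generic h a q 0%N =
  vander (node a q) *m eig_mx h a q *m invmx (vander (node a q)).
Proof.
move=> adm; rewrite /U_generic /mps_mul !big_ord_recl !big_ord0 !addr0 /=.
rewrite /mps_const /= /mps_inv /= /mps_subst_pow dvdn0 div0n (Psi'_frob0 adm) (Phi_ratio_diagE adm).
congr (_ *m _ *m _); rewrite Psi'_0; apply/matrixP => i j; rewrite !mxE.
by case: adm => _ ha /andP[_ q1]; rewrite (qpow_natM p_prime) //; apply: in_Zp_pM.
Qed.

Lemma U_generic0_eigen h a q i : admissible h a q -> vander (node a q) \in unitmx ->
  U_generic h a q 0%N *m fixed_pt a q i = U0_eigenvalue h a q i *: fixed_pt a q i.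
Proof.
move=> adm u; rewrite (U_generic0 adm) (fixed_ptE i adm) colE mulmxA mulmxKV // -mulmxA.
rewrite -colE; apply/colP => k; rewrite !mxE (bigD1 i) //= big1 ?addr0 => [|j ji].
  rewrite !mxE eqxx mulr1n [RHS]mulrC; congr (_ * _); rewrite (bigD1 i) //=.
  by rewrite big1 ?addr0 ?mxE ?eqxx ?mulr1 // => j ji; rewrite !mxE (negPf ji) mulr0.
by rewrite !mxE (negPf ji) mulr0n mulr0.
Qed.

End GenericConstantTerm.

(** * Eigenvectors of matrix windows *)

Section EigenMatrix.
Variables (R : realType) (p : nat).
Variable Omega : completedAlgClosureQp R p.
Variables (n : nat) (v : 'cV[Omega]_n.+1).
Local Notation mxA := (mx_alg Omega n).
Local Notation bsA := (base_alg Omega).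

(** The window is a polynomial in [Z], so an eigenvector of [Z] remains one, with the same
    polynomial evaluated at [z]. *)
Lemma gwin_eigen q (Z : mxA) (z : Omega) m : (Z : 'M_n.+1) *m v = z *: v ->
  (gwin q Z m : 'M_n.+1) *m v = (gwin (A := bsA) q z m : Omega) *: v.
Proof.
move=> hZ.
have prodE (M M' : 'M[Omega]_n.+1) (c c' : Omega) : M *m v = c *: v -> M' *m v = c' *: v ->
    (M * M') *m v = (c * c') *: v.
  by move=> h h'; rewrite -mulmxA h' -scalemxAr h scalerA mulrC.
rewrite /gwin /=; apply: (prodE); first by rewrite mul_scalar_mx.
apply: (big_ind2 (fun (M : 'M[Omega]_n.+1) (c : Omega) => M *m v = c *: v)).
- by rewrite mul1mx scale1r.
- by move=> *; apply: (prodE).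
move=> e _; rewrite /win_factor /= mulmxBl scalerBl mul_scalar_mx; congr (_ - _).
by rewrite -mulmxA hZ mul_scalar_mx scalerA.
Qed.

Lemma prod_eigen (I : Type) (s : seq I) (F : I -> 'M[Omega]_n.+1) (f : I -> Omega) :
  (forall i, F i *m v = f i *: v) -> (\prod_(i <- s) F i) *m v = (\prod_(i <- s) f i) *: v.
Proof.
move=> h; apply: (big_ind2 (fun (M : 'M[Omega]_n.+1) (c : Omega) => M *m v = c *: v)).
- by rewrite mul1mx scale1r.
- by move=> M c M' c' hM hM'; rewrite -mulmxA hM' -scalemxAr hM scalerA mulrC.
- by move=> i _.
Qed.

End EigenMatrix.

(** * Companion matrices and their dependence on the roots *)

Section CompanionMatrix.
Variables (R : realType) (p : nat).
Variable Omega : completedAlgClosureQp R p.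
Variable n : nat.
Local Notation abs := (@pabs R p Omega).
Local Notation polA := (poly_alg Omega).
Local Notation mxA := (mx_alg Omega n).
Implicit Types (y : 'I_n.+1 -> Omega).

Definition root_poly y : {poly Omega} := \prod_j ('X - (y j)%:P).

(** Row i holds the coefficients of X^(i+1) reduced modulo the monic [root_poly y] of degree n + 1,
    which alters the last row only. It is multiplication by X in the basis of powers of X. *)
Definition companion y : 'M[Omega]_n.+1 :=
  \matrix_(i, k) ('X^(i.+1) - (if i == ord_max then root_poly y else 0))`_k.

Definition powers (c : Omega) : 'cV[Omega]_n.+1 := \col_i c ^+ i.

Lemma coef_powers (P : {poly Omega}) c : (size P <= n.+1)%N ->
  \sum_(k < n.+1) P`_k * powers c k 0 = P.[c].
Proof.
by move=> sP; rewrite (horner_coef_wide _ sP); apply: eq_bigr => k _; rewrite mxE.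
Qed.

(** Row i evaluated at the root y_j gives y_j^(i+1), whether or not roots coincide. *)
Lemma companion_powers y j : companion y *m powers (y j) = y j *: powers (y j).
Proof.
apply/colP => i; rewrite !mxE -exprS.
under eq_bigr => k _ do rewrite mxE.
rewrite coef_powers ?hornerD ?hornerN ?hornerXn.
  case: ifP => _; last by rewrite horner0 subr0.
  by rewrite horner_prod (bigD1 j) //= hornerXsubC subrr mul0r subr0.
have sP : size (root_poly y) = n.+2 by rewrite size_prod_XsubC /index_enum -enumT size_enum_ord.
have mP : (root_poly y)`_n.+1 = 1.
  by have /monicP := monic_prod_XsubC (index_enum 'I_n.+1) xpredT y; rewrite lead_coefE sP.
case: ifP => [/eqP ->|/eqP /eqP hi].
  apply/leq_sizeP => k; rewrite leq_eqVlt coefB coefXn => /orP[/eqP <-|hk].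
    by rewrite eqxx mP subrr.
  by rewrite nth_default ?sP // subr0 /= gtn_eqF.
rewrite subr0 size_polyXn ltn_neqAle ltn_ord andbT; apply: contraNneq hi => -[] hi.
by apply/eqP/val_inj.
Qed.

Lemma bd_root_factor c : abs c <= 1 -> bd (n := polA) 1 ('X - c%:P).
Proof.
move=> c1; split=> [|i]; first exact: ler01.
by rewrite coefB coefX coefC; apply: absB_le; case: eqP => _; rewrite ?abs0 ?abs1.
Qed.

Lemma bd_root_poly y : (forall j, abs (y j) <= 1) -> bd (n := polA) 1 (root_poly y).
Proof.
by move=> hy; apply: (@bd_prod1 _ _ _ polA) => j _; apply: bd_root_factor.
Qed.

Lemma bd_companion y : (forall j, abs (y j) <= 1) -> bd (n := mxA) 1 (companion y).
Proof.
move=> hy i k; rewrite mxE coefB coefXn absB_le //.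
  by case: eqP => _; rewrite ?abs0 ?abs1.
case: ifP => _; last by rewrite coef0 abs0.
by have [] := bd_root_poly hy.
Qed.

(** Only the last row changes, by coefficients of [root_poly], a product of linear factors of Gauss
    norm at most 1, each moving by at most [r]. *)
Lemma companion_lip y y' r : 0 <= r -> (forall j, abs (y j) <= 1) -> (forall j, abs (y' j) <= 1) ->
  (forall j, abs (y j - y' j) <= r) -> bd (n := mxA) r (companion y - companion y').
Proof.
move=> r0 hy hy' hyy i k; rewrite !mxE -coefB.
rewrite opprD addrACA subrr add0r -opprD coefN absN.
case: ifP => _; last by rewrite subr0 coef0 abs0.
suff [_ h] : bd (n := polA) r (root_poly y - root_poly y') by exact: h.
apply: (@bd_cong_prod _ _ _ polA) => // j _; try exact: bd_root_factor.
have -> : 'X - (y j)%:P - ('X - (y' j)%:P) = (y' j - y j)%:P.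
  by rewrite polyCB opprD opprK addrACA subrr add0r addrC.
by apply: (@bd_in _ _ _ polA); rewrite absBC.
Qed.

End CompanionMatrix.

(** * A model of the constant term that allows coinciding nodes *)

Section ConstantTermModel.
Variables (R : realType) (p : nat).
Hypothesis p_prime : prime p.
Variable Omega : completedAlgClosureQp R p.
Variable n : nat.
Local Notation abs := (@pabs R p Omega).
Local Notation cvg := (cvg_seq_to abs).
Local Notation pinv := (p%:R^-1 : R).
Local Notation mxA := (mx_alg Omega n).
Local Notation bsA := (base_alg Omega).
Local Notation powers := (powers (Omega := Omega) n).
Implicit Types (q : Omega) (x : 'I_n.+1 -> Omega).

(* [tau] is |q - 1|; [w] is small enough for the argument [shift_mx] of the windows, which
   involves w / (1 - q), to have norm at most [theta], and large enough for the rescaled nodes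
   (x - 1) / w to be integral. *)
Variables (theta tau : R) (w : Omega).
Hypotheses (t_ge : pinv <= theta) (t_lt1 : theta < 1) (tau_gt0 : 0 < tau) (tau_t : tau <= theta)
  (absw : abs w = tau * theta).
Let t_ge0 : 0 <= theta := theta_ge0 p_prime t_ge.

Let t_gt0 : 0 < theta. Proof. exact: lt_le_trans (pinv_gt0 R p_prime) t_ge. Qed.
Let w_neq0 : w != 0. Proof. by rewrite -abs_neq0 absw mulf_neq0 // gt_eqF. Qed.
Let w_lt1 : abs w < 1.
Proof. by rewrite absw; apply: le_lt_trans t_lt1; rewrite ler_piMl // (le_trans tau_t) // ltW. Qed.

Definition near_one x := forall j, abs (x j - 1) <= abs w.
Definition rescale x : 'I_n.+1 -> Omega := fun j => (x j - 1) / w.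
(** This is (X / x_j - 1) / (1 - q) for X = 1 + w C, with C the companion matrix of the rescaled
    nodes. On the eigenvector of node i it acts as (x_i / x_j - 1) / (1 - q). *)
Definition shift_mx q x j : mxA :=
  na_in mxA (((x j)^-1 - 1) / (1 - q)) + na_in mxA ((x j)^-1 * w / (1 - q)) * (companion (rescale x) : mxA).
(* V diag_i(phi_i) V^-1 at h = m in the basis of powers of the rescaled nodes; unlike V^-1 it is
   defined and continuous where nodes coincide. *)
Definition model_mx q x m : mxA :=
  (\prod_(j < n.+1) gwin q (shift_mx q x j) (p * m)) * na_in mxA ((qgamma_nat q (p * m))^-1 ^+ n.+1).

Lemma abs_x x j : near_one x -> abs (x j) = 1.
Proof.
move=> hx; rewrite -(@abs1 R p Omega); apply: abs_near; rewrite abs1.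
exact: le_lt_trans (hx j) w_lt1.
Qed.

Lemma x_neq0 x j : near_one x -> x j != 0.
Proof. by move=> hx; rewrite -abs_neq0 (abs_x j hx) oner_eq0. Qed.

Lemma abs_rescale x j : near_one x -> abs (rescale x j) <= 1.
Proof. by move=> hx; rewrite absf_div ler_pdivrMr ?abs_gt0 // mul1r. Qed.

Lemma abs_xV_sub1 x j : near_one x -> abs ((x j)^-1 - 1) <= abs w.
Proof.
by move=> hx; rewrite -[1]invr1; apply: abs_invB; rewrite ?(abs_x j hx) ?abs1.
Qed.

Lemma abs_1q q : abs (q - 1) = tau -> abs (1 - q) = tau.
Proof. by rewrite absBC. Qed.

Lemma q_neq1_tau q : abs (q - 1) = tau -> q != 1.
Proof. by move=> h; rewrite -subr_eq0 -abs_gt0 h. Qed.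

Lemma bd_shift_mx q x j : near_one x -> abs (q - 1) = tau -> bd theta (shift_mx q x j).
Proof.
move=> hx hq; apply: bdD => //.
  apply: bd_in; rewrite absf_div (abs_1q hq) ler_pdivrMr // mulrC -absw.
  exact: abs_xV_sub1.
apply: bdM1; last by apply: bd_companion => k; apply: abs_rescale.
apply: bd_in; rewrite absf_div pabsM absV (abs_x j hx) invr1 mul1r (abs_1q hq) absw.
by rewrite ler_pdivrMr // mulrC.
Qed.

Lemma q_t_tau q : abs (q - 1) = tau -> abs (q - 1) <= theta.
Proof. by move=> ->. Qed.

Lemma hq_tau q : abs (q - 1) = tau -> 0 < abs (q - 1) < 1.
Proof. by move=> ->; rewrite tau_gt0 (le_lt_trans tau_t). Qed.

Lemma bd_qgamma_natVX q m : abs (q - 1) = tau ->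
  bd (n := bsA) 1 ((qgamma_nat q m)^-1 ^+ n.+1).
Proof.
by move=> hq; apply: (@bdX1 _ _ _ bsA) => /=; rewrite absV (abs_qgamma_nat p_prime (hq_tau hq)) invr1.
Qed.

Lemma bd_Hfactor q x m j : near_one x -> abs (q - 1) = tau -> bd 1 (gwin q (shift_mx q x j) m).
Proof.
move=> hx hq; apply: (bd_gwin t_lt1 (q_neq1_tau hq) (q_t_tau hq)).
exact: bd_shift_mx.
Qed.

Lemma bd_Hprod q x m : near_one x -> abs (q - 1) = tau ->
  bd 1 (\prod_(j < n.+1) gwin q (shift_mx q x j) m).
Proof. by move=> hx hq; apply: bd_prod1 => j _; apply: bd_Hfactor. Qed.

Lemma bd_congVX r q q' m m' : 0 <= r -> abs (q - 1) = tau -> abs (q' - 1) = tau ->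
  abs (qgamma_nat q m - qgamma_nat q' m') <= r ->
  abs ((qgamma_nat q m)^-1 ^+ n.+1 - (qgamma_nat q' m')^-1 ^+ n.+1) <= r.
Proof.
move=> r0 hq hq' h.
by apply: abs_exprB; rewrite ?absV ?(abs_qgamma_nat p_prime (hq_tau hq))
  ?(abs_qgamma_nat p_prime (hq_tau hq')) ?invr1 //; apply: abs_invB => //;
  rewrite ?(abs_qgamma_nat p_prime (hq_tau hq)) ?(abs_qgamma_nat p_prime (hq_tau hq')).
Qed.

(** Uniform continuity in h. Multiplication by p turns a congruence modulo p^N into one modulo
    p^(N+1), which makes up for the power lost in [gwin_cong]. *)
Lemma model_mx_cong q x m l N : near_one x -> abs (q - 1) = tau -> m = l %[mod p ^ N]%N ->
  bd (theta ^+ N) (model_mx q x m - model_mx q x l).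
Proof.
move=> hx hq ml; have tN : 0 <= theta ^+ N by rewrite exprn_ge0.
have pml : (p * m)%N = (p * l)%N %[mod p ^ N.+1]%N by rewrite expnS -!muln_modr ml.
have q1 := q_neq1_tau hq; have qt := q_t_tau hq.
apply: bd_congM => //; first exact: bd_Hprod.
- by apply: bd_in; apply: bd_qgamma_natVX.
- apply: bd_cong_prod => // j _; try exact: bd_Hfactor.
  exact: (gwin_cong p_prime t_ge t_lt1 q1 qt (bd_shift_mx j hx hq)).
rewrite -rmorphB; apply: bd_in; apply: bd_congVX => //.
rewrite -!(gwin0 q); exact: (gwin_cong p_prime t_ge t_lt1 q1 qt (bd0 bsA t_ge0)).
Qed.

(** Division by 1 - q costs a factor [tau] and rescaling the nodes costs |w|; hence the tolerances
    on q and on the nodes. *)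
Lemma shift_mx_lip q q' x x' j r : 0 <= r -> near_one x -> near_one x' -> abs (q - 1) = tau ->
  abs (q' - 1) = tau -> abs (q - q') <= r * tau -> (forall j, abs (x j - x' j) <= r * abs w) ->
  bd r (shift_mx q x j - shift_mx q' x' j).
Proof.
move=> r0 hx hx' hq hq' qq xx.
have tau1 : tau <= 1 by apply: le_trans tau_t (ltW _).
have rw1 : r * abs w <= r * tau.
  by rewrite absw ler_wpM2l // ler_piMr ?ltW.
have divB (u v : Omega) : abs v <= tau -> abs (u - v) <= r * tau ->
    abs (u / (1 - q) - v / (1 - q')) <= r.
  move=> v1 uv.
  have q0 : 1 - q != 0 by rewrite -abs_gt0 (abs_1q hq).
  have q0' : 1 - q' != 0 by rewrite -abs_gt0 (abs_1q hq').
  have -> : u / (1 - q) - v / (1 - q') = (u - v) / (1 - q) + v / (1 - q') * ((q - q') / (1 - q)).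
    by field; rewrite q0 q0'.
  apply: absD_le; first by rewrite absf_div (abs_1q hq) ler_pdivrMr.
  rewrite pabsM !absf_div (abs_1q hq) (abs_1q hq') -[X in _ <= X]mul1r ler_pM //.
  - by rewrite divr_ge0 ?pabs_ge0 // ltW.
  - by rewrite divr_ge0 ?pabs_ge0 // ltW.
  - by rewrite ler_pdivrMr // mul1r.
  - by rewrite ler_pdivrMr.
have wtau : abs w <= tau by rewrite absw ler_piMr ?ltW.
have xVB : abs ((x j)^-1 - (x' j)^-1) <= r * abs w.
  by apply: abs_invB; rewrite ?(abs_x j hx) ?(abs_x j hx').
rewrite /shift_mx opprD addrACA -rmorphB; apply: bdD => //.
  apply: bd_in; apply: divB; first by apply: le_trans wtau; apply: abs_xV_sub1.
  by rewrite opprB addrA subrK; apply: le_trans rw1.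
apply: bd_congM => //.
- apply: bd_in; rewrite absf_div pabsM absV (abs_x j hx) invr1 mul1r (abs_1q hq).
  by rewrite ler_pdivrMr // mul1r.
- by apply: bd_companion => k; apply: abs_rescale.
- rewrite -rmorphB; apply: bd_in; apply: divB.
    by rewrite pabsM absV (abs_x j hx') invr1 mul1r.
  rewrite -mulrBl pabsM; apply: le_trans _ (_ : r * tau * 1 <= _); last by rewrite mulr1.
  by apply: ler_pM; rewrite ?pabs_ge0 //; [exact: le_trans xVB rw1 | exact: ltW].
apply: companion_lip => // k; try exact: abs_rescale.
rewrite /rescale -mulrBl opprB addrA subrK absf_div ler_pdivrMr ?abs_gt0 //.
Qed.

Lemma model_mx_lip q q' x x' m r : 0 <= r -> near_one x -> near_one x' -> abs (q - 1) = tau ->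
  abs (q' - 1) = tau -> abs (q - q') <= r * tau -> (forall j, abs (x j - x' j) <= r * abs w) ->
  bd r (model_mx q x m - model_mx q' x' m).
Proof.
move=> r0 hx hx' hq hq' qq xx.
have qq' : abs (q - q') <= r.
  by apply: le_trans qq _; rewrite ler_piMr // (le_trans tau_t) // ltW.
have [q1 q1'] := (q_neq1_tau hq, q_neq1_tau hq').
have [qt qt'] := (q_t_tau hq, q_t_tau hq').
apply: bd_congM => //; first exact: bd_Hprod.
- by apply: bd_in; apply: bd_qgamma_natVX.
- apply: bd_cong_prod => // j _; try exact: bd_Hfactor.
  apply: (gwin_lip t_lt1 _ q1 q1' qt qt' (bd_shift_mx j hx hq) (bd_shift_mx j hx' hq')) => //.
  exact: shift_mx_lip.
rewrite -rmorphB; apply: bd_in; apply: bd_congVX => //.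
rewrite -(gwin0 q) -(gwin0 q').
apply: (gwin_lip t_lt1 _ q1 q1' qt qt' (bd0 bsA t_ge0) (bd0 bsA t_ge0)) => //.
by rewrite subrr; apply: bd0.
Qed.

(** By [gwin_gamma] the factor j acts as Gamma(p(a_i - a_j + m)) / Gamma(p(a_i - a_j)); the n + 1
    scalars 1 / Gamma(p m) complete the eigenvalue. *)
Lemma model_mx_eigen h a q i m : (forall j, in_Zp (a j)) -> abs (q - 1) = tau ->
  near_one (node a q) -> h = m%:R ->
  (model_mx q (node a q) m : 'M_n.+1) *m powers (rescale (node a q) i)
    = U0_eigenvalue h a q i *: powers (rescale (node a q) i).
Proof.
move=> ha hq hx ->; set x := node a q; set v := powers _.
have hq' := hq_tau hq; have ql : abs (q - 1) < 1 by case/andP: hq'.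
pose z j := (x i / x j - 1) / (1 - q).
have Zv j : (shift_mx q x j : 'M_n.+1) *m v = z j *: v.
  rewrite /shift_mx /= mulmxDl mul_scalar_mx -mulmxA companion_powers mul_scalar_mx scalerA -scalerDl.
  congr (_ *: _); rewrite /z /rescale; field.
  by rewrite (x_neq0 j hx) w_neq0 subr_eq0 eq_sym (q_neq1_tau hq).
rewrite /model_mx /= -mulmxA mul_scalar_mx -scalemxAr (prod_eigen _ (fun j => gwin_eigen q (p * m) (Zv j))).
rewrite scalerA; congr (_ *: _); rewrite mulrC.
have -> (g : Omega) : g ^+ n.+1 = \prod_(j < n.+1) g by rewrite prodr_const card_ord.
rewrite -big_split /=; apply: eq_bigr => j _.
have hb : in_Zp (a i - a j) by apply: (in_ZpB p_prime).
have := gwin_gamma p_prime hq' m hb.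
have -> : qpow q (p%:R * (a i - a j)) = x i / x j.
  by rewrite mulrBr (qpowB p_prime) //; apply: in_Zp_pM.
move=> <-; rewrite -natrM (qgammaP p_prime hq').2.
have aux (g B G : Omega) : B != 0 -> G != 0 -> g * G^-1 = g * B / (B * G).
  by move=> B0 G0; field; rewrite B0 G0.
apply: aux; first by apply: (qgamma_neq0 p_prime hq'); apply: in_Zp_pM.
by rewrite -abs_neq0 (abs_qgamma_nat p_prime hq') oner_eq0.
Qed.

(** Sends the powers of (x - 1) / w to the powers of x, and [scale_mx] does the reverse. Both depend
    on w only, so conjugating by them costs a constant independent of the nodes. *)
Definition unscale_mx : mxA := \matrix_(i, k) ((1 + w *: 'X) ^+ i)`_k.
Definition scale_mx : mxA := \matrix_(i, k) ((w^-1 *: ('X - 1)) ^+ i)`_k.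

Lemma size_lin_exp (P : {poly Omega}) i : (size P <= 2)%N -> (size (P ^+ i) <= i.+1)%N.
Proof.
move=> sP; elim: i => [|i IH]; first by rewrite expr0 size_poly1.
rewrite exprS; apply: leq_trans (size_polyMleq _ _) _; lia.
Qed.

(** P^i has degree at most i <= n, so row i contains all its coefficients and evaluates it at
    [c]. *)
Lemma basis_change (P : {poly Omega}) (c : Omega) : (size P <= 2)%N ->
  (\matrix_(i, k) (P ^+ i)`_k : 'M_n.+1) *m powers c = powers P.[c].
Proof.
move=> sP; apply/colP => i; rewrite !mxE; under eq_bigr => k _ do rewrite mxE.
rewrite coef_powers ?horner_exp //; apply: leq_trans (size_lin_exp i sP) _; exact: ltn_ord.
Qed.

Lemma unscale_mx_powers x j : (unscale_mx : 'M_n.+1) *m powers (rescale x j) = powers (x j).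
Proof.
rewrite basis_change ?hornerE; first by rewrite /rescale /= mulrAC mulfV // mul1r addrC subrK.
apply: leq_trans (size_polyD _ _) _; rewrite size_poly1 geq_max /=.
by apply: leq_trans (size_scale_leq _ _) _; rewrite size_polyX.
Qed.

Lemma scale_mx_powers x j : (scale_mx : 'M_n.+1) *m powers (x j) = powers (rescale x j).
Proof.
rewrite basis_change ?hornerE; first by rewrite /rescale /= [in RHS]mulrC.
by apply: leq_trans (size_scale_leq _ _) _; rewrite -polyC1 size_XsubC.
Qed.

Lemma col_vander x j : col j (vander x) = powers (x j).
Proof. by apply/colP => i; rewrite !mxE. Qed.

Lemma mul_vander (M : 'M[Omega]_n.+1) x y :
  (forall j, M *m powers (x j) = powers (y j)) -> M *m vander x = vander y.
Proof.
move=> h; apply/matrixP => i j.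
by have /colP/(_ i) := h j; rewrite -!col_vander colE mulmxA -!colE !mxE.
Qed.

Lemma mul_vander_diag (M : 'M[Omega]_n.+1) x (d : 'rV_n.+1) :
  (forall j, M *m powers (x j) = d 0 j *: powers (x j)) -> M *m vander x = vander x *m diag_mx d.
Proof.
move=> h; rewrite mul_mx_diag; apply/matrixP => i j.
have /colP/(_ i) := h j; rewrite -!col_vander colE mulmxA -!colE !mxE => ->.
by rewrite mulrC.
Qed.

Lemma mx_bd_exists (M : mxA) : exists2 K, 0 < K & bd K M.
Proof.
exists (1 + \sum_i \sum_j abs ((M : 'M_n.+1) i j)) => [|i j].
  by rewrite ltr_pwDl ?ltr01 // sumr_ge0 // => i _; rewrite sumr_ge0 // => j _; apply: pabs_ge0.
apply: (@le_trans _ _ (\sum_k abs ((M : 'M_n.+1) i k))).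
  by rewrite (bigD1 j) //= lerDl sumr_ge0 // => k _; apply: pabs_ge0.
apply: (@le_trans _ _ (\sum_l \sum_k abs ((M : 'M_n.+1) l k))); last by rewrite lerDr ler01.
rewrite [X in _ <= X](bigD1 i) //= lerDl sumr_ge0 // => l _.
by rewrite sumr_ge0 // => k _; apply: pabs_ge0.
Qed.

Lemma cvg_eigenvalue h (u : nat -> Omega) a q i : (forall j : 'I_n.+1, in_Zp (a j)) -> abs (q - 1) = tau ->
  in_Zp h -> (forall k, in_Zp (u k)) -> cvg u h ->
  cvg (fun k => U0_eigenvalue (u k) a q i) (U0_eigenvalue h a q i).
Proof.
move=> ha hq hh hu cu; apply: cvg_prod => j _.
have hb : in_Zp (a i - a j) by apply: (in_ZpB p_prime).
exact: (cvg_gamma_ratio p_prime (hq_tau hq) (fun=> hb) hb hu hh (cvg_cst _) cu).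
Qed.

Lemma near_node a q : (forall j, in_Zp (a j)) -> abs (q - 1) = tau -> near_one (node a q).
Proof.
move=> ha hq j; have ql : abs (q - 1) < 1 by case/andP: (hq_tau hq).
rewrite -[X in abs (_ - X) <= _](qpow0 p_prime q) absw -hq -(expr1 theta).
apply: (qpow_lip p_prime t_ge t_lt1 (q_t_tau hq)); first exact: in_Zp_pM.
  exact: (in_Zp_nat p_prime Omega 0).
rewrite subr0 pabsM pabs_p expr1 ler_piMr ?(ltW (pinv_gt0 R p_prime)) //.
exact: (in_Zp_abs_le1 p_prime).
Qed.

(** At natural h the conjugate equals the model, since they share a basis of eigenvectors and the
    eigenvalues. The approximations of h are eventually congruent to m modulo p^N, and
    [model_mx_cong] gives a bound free of the inverse Vandermonde matrix. *)
Lemma generic_model h a q m N : (forall j, in_Zp (a j)) -> in_Zp h -> abs (q - 1) = tau ->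
  vander (node a q) \in unitmx -> abs (h - m%:R) <= pinv ^+ N ->
  bd (n := mxA) (theta ^+ N)
    (vander (rescale (node a q)) *m eig_mx h a q *m invmx (vander (rescale (node a q))) - model_mx q (node a q) m).
Proof.
move=> ha hh hq uV hm; set x := node a q; set Y := vander (rescale x).
have hx : near_one x := near_node ha hq.
have uY : Y \in unitmx.
  move: uV; rewrite -/x -(mul_vander (fun j => unscale_mx_powers x j)) unitmx_mul; by case/andP.
have HY l : (model_mx q x l : 'M_n.+1) = Y *m eig_mx l%:R a q *m invmx Y.
  rewrite -[LHS](mulmxK uY); congr (_ *m _); apply: mul_vander_diag => j.
  by rewrite mxE; apply: model_mx_eigen.
have [u hu] := Zp_seq p_prime hh.
have cE i : cvg (fun k => U0_eigenvalue (u k)%:R a q i) (U0_eigenvalue h a q i).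
  apply: cvg_eigenvalue => // [k|]; first exact: in_Zp_nat.
  exact: (cvg_rate p_prime).
move=> i j.
have cY : cvg (fun k => (model_mx q x (u k) : 'M_n.+1) i j) ((Y *m eig_mx h a q *m invmx Y) i j).
  apply: cvg_ext (fun k => (Y *m eig_mx (u k)%:R a q *m invmx Y) i j) _ _ _ _ => [k|].
    by rewrite HY.
  rewrite mul_mx_diag !mxE.
  apply: cvg_ext (cvg_sum _ _) => [k|l _].
    by rewrite mul_mx_diag !mxE.
  rewrite !mxE; apply: cvg_ext (cvgM (cvgM (cvg_cst _) (cE l)) (cvg_cst _)) => k.
  by rewrite !mxE.
rewrite mxE [X in _ + X]mxE; apply: (cvg_abs_le (cvgB cY (cvg_cst _))).
exists N => k Nk; have := @model_mx_cong q x (u k) m N hx hq _ i j; rewrite !mxE; apply.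
apply/eqP; rewrite -(abs_natB_le_exp p_prime Omega); apply: (@abs_tri_le _ _ _ _ h) => //.
rewrite absBC; apply: le_trans (hu k) _.
by rewrite ler_wiXn2l // ltW ?pinv_gt0 ?pinv_lt1.
Qed.

End ConstantTermModel.

(** * Density of generic parameters *)

Section GenericDensity.
Variables (R : realType) (p : nat).
Hypothesis p_prime : prime p.
Variable Omega : completedAlgClosureQp R p.
Local Notation abs := (@pabs R p Omega).
Local Notation pinv := (p%:R^-1 : R).

(** If q is a root of unity of p-power order, it is multiplied by 1 + p^N, a natural number close to
    1 and of infinite order. *)
Lemma non_root_dense (q : Omega) (d : R) : 0 < abs (q - 1) < 1 -> 0 < d ->
  exists q', [/\ abs (q' - q) < d, 0 < abs (q' - 1) < 1 & forall N, q' ^+ (p ^ N) != 1].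
Proof.
move=> hq d0; have [q0 q1] := andP hq.
have [h|] := pselect (forall N, q ^+ (p ^ N) != 1).
  by exists q; split=> //; rewrite subrr abs0.
move=> /existsNP[r /negP/negPn/eqP qr].
have dq : 0 < Num.min d (abs (q - 1)) by rewrite lt_min d0.
have [N hN] := pinv_exp_small p_prime dq.
have {hN} := hN N (leqnn N); rewrite lt_min => /andP[h1 h2].
pose u := (1 + p ^ N)%N.
have E : abs (q * u%:R - q) = pinv ^+ N.
  have -> : q * u%:R - q = q * p%:R ^+ N by rewrite /u natrD natrX; ring.
  by rewrite pabsM (abs_q (theta_of_lt1 p_prime q1) (theta_of_q q)) mul1r absX pabs_p.
exists (q * u%:R); split; first by rewrite E.
  suff -> : abs (q * u%:R - 1) = abs (q - 1) by [].
  by apply: abs_near; rewrite opprB addrA subrK E.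
move=> M; apply/negP => /eqP h.
have : (q * u%:R) ^+ (p ^ (M + r)) = 1 by rewrite expnD exprM h expr1n.
rewrite exprMn addnC expnD exprM qr expr1n mul1r -natrX -expnD => /eqP.
have un1 : (1 < u ^ p ^ (r + M))%N.
  rewrite -[1%N](exp1n (p ^ (r + M))) ltn_exp2r ?expn_gt0 ?prime_gt0 //.
  by rewrite /u -addn1 leq_add2l expn_gt0 prime_gt0.
rewrite -[1]/(1%:R) -subr_eq0 -natrB ?(ltnW un1) // natr_Omega_neq0 // subn_eq0.
by rewrite leqNgt un1.
Qed.

(** If primes l0 and l both give integers, subtraction yields p^N c (l - l0) = (m0 - m) l0 l, so l
    divides the left side. That is impossible for l > l0 + b + p. *)
Lemma rational_shift_not_int (alpha : Omega) (c : int) (b N : nat) : c != 0 -> (`|c| <= b)%N ->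
  exists L, forall l, prime l -> (L < l)%N ->
    forall m : int, alpha + p%:R ^+ N * c%:~R / l%:R != m%:~R.
Proof.
move=> c0 cb; pose bad l := exists m : int, alpha + p%:R ^+ N * c%:~R / l%:R = m%:~R.
have [[l0 [pl0 [m0 bad0]]]|none] := pselect (exists l, prime l /\ bad l); last first.
  by exists 0%N => l pl _ m; apply/eqP => h; apply: none; exists l; split=> //; exists m.
exists (l0 + b + p)%N => l pl ll m; apply/eqP => h.
have ln0 : l%:R != 0 :> Omega by rewrite natr_Omega_neq0 // -lt0n prime_gt0.
have ln00 : l0%:R != 0 :> Omega by rewrite natr_Omega_neq0 // -lt0n prime_gt0.
have E : (p%:Z ^+ N * c * (l%:Z - l0%:Z) - (m0 - m) * l0%:Z * l%:Z)%:~R == 0 :> Omega.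
  rewrite !(rmorphB, rmorphM, rmorphXn) /= -bad0 -h -!pmulrn; apply/eqP; field.
  by rewrite ln0 ln00.
move: E; rewrite intr_Omega_eq0 // subr_eq0 => /eqP E.
have : (l %| absz (p%:Z ^+ N * c * (l%:Z - l0%:Z))%R)%N by rewrite E abszM dvdn_mull.
rewrite !abszM abszX !Euclid_dvdM // => /orP[/orP[]|].
- rewrite Euclid_dvdX // => /andP[/dvdn_leq]; rewrite prime_gt0 // => /(_ isT); lia.
- move/dvdn_leq; rewrite absz_gt0 => /(_ c0) lc.
  by move: ll; rewrite ltnNge (leq_trans lc) // (leq_trans cb) // addnAC leq_addl.
have -> : absz (l%:Z - l0%:Z)%R = (l - l0)%N by rewrite subzn //; lia.
move/dvdn_leq; rewrite subn_gt0 => /(_ ltac:(lia)); have := prime_gt0 pl0; lia.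
Qed.

(** Each a_i moves by p^N i / l for a large prime l. All integers are excluded, not only 0, so that
    the denominators of [Psi'] do not vanish either. *)
Lemma non_int_dense n (a : 'I_n -> Omega) (d : R) : (forall i, in_Zp (a i)) -> 0 < d ->
  exists a' : 'I_n -> Omega, [/\ forall i, in_Zp (a' i), forall i, abs (a' i - a i) < d &
    forall i j (m : int), i != j -> p%:R * (a' i - a' j) != m%:~R].
Proof.
move=> ha d0; have [N hN] := pinv_exp_small p_prime d0.
have H (ij : 'I_n * 'I_n) : exists L, ij.1 != ij.2 -> forall l, prime l -> (L < l)%N ->
    forall m : int, p%:R * (a ij.1 - a ij.2) + p%:R ^+ N.+1 * (ij.1%:Z - ij.2%:Z)%:~R / l%:R != m%:~R.
  have [->|ne] := eqVneq ij.1 ij.2; first by exists 0%N.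
  have c0 : (ij.1%:Z - ij.2%:Z) != 0 by rewrite subr_eq0 eqz_nat.
  have [|L hL] := rational_shift_not_int (p%:R * (a ij.1 - a ij.2)) (b := n) N.+1 c0.
    by have := ltn_ord ij.1; have := ltn_ord ij.2; lia.
  by exists L.
have [L hL] := choice H.
(* [l] exceeds every [L], and exceeds p so that 1 / l lies in Z_p. *)
have [l lL pl] := prime_above (\max_ij L ij + p)%N.
have pnl : ~~ (p %| l)%N.
  rewrite dvdn_prime2 //; apply/negP => /eqP E; rewrite E in lL.
  by move: lL; rewrite ltnNge leq_addl.
have l0 : l%:R != 0 :> Omega by rewrite natr_Omega_neq0 // -lt0n prime_gt0.
exists (fun i => a i + p%:R ^+ N * i%:R / l%:R); split=> [i|i|i j m ij].
- apply: (in_ZpD p_prime) => //; apply: (in_ZpM p_prime); last exact: in_Zp_natV.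
  by rewrite -natrX -natrM; apply: in_Zp_nat.
- rewrite addrC addKr absf_div pabsM absX pabs_p (abs_nat_unit p_prime Omega pnl) divr1.
  apply: le_lt_trans (hN N (leqnn N)); rewrite ler_piMr ?abs_nat_le1 //.
  by rewrite exprn_ge0 // ltW ?pinv_gt0.
have := hL (i, j) ij l pl _ m; rewrite /=.
have -> : p%:R * (a i + p%:R ^+ N * i%:R / l%:R - (a j + p%:R ^+ N * j%:R / l%:R)) =
    p%:R * (a i - a j) + p%:R ^+ N.+1 * (i%:Z - j%:Z)%:~R / l%:R.
  by rewrite rmorphB /= -!pmulrn exprS; field.
apply; apply: leq_ltn_trans lL; apply: leq_trans (leq_addr _ _).
exact: (leq_bigmax (i, j)).
Qed.

(** The determinant is a product of differences of nodes, which are nonzero by [qpow_eq1]. *)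
Lemma vander_unit n (a : 'I_n -> Omega) q : (forall i, in_Zp (a i)) -> abs (q - 1) < 1 ->
  (forall N, q ^+ (p ^ N) != 1) -> (forall i j, i != j -> p%:R * (a i - a j) != 0) ->
  vander (node a q) \in unitmx.
Proof.
move=> ha q1 qN aN; rewrite unitmxE unitfE.
have -> : vander (node a q) = Vandermonde n (\row_j node a q j).
  by apply/matrixP => i j; rewrite !mxE.
rewrite det_Vandermonde; apply/prodf_neq0 => i _; apply/prodf_neq0 => j ij.
rewrite !mxE subr_eq0; apply/negP => /eqP E.
have ji : j != i by rewrite -val_eqE /= gtn_eqF.
move/negP: (aN j i ji); apply; apply/eqP; apply: (qpow_eq1 p_prime q1 qN).
  by apply: in_Zp_pM => //; apply: (in_ZpB p_prime).
rewrite mulrBr (qpowB p_prime) //; try exact: in_Zp_pM.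
rewrite -/(node a q j) -/(node a q i) E mulfV // /node.
by apply: (qpow_neq0 p_prime) => //; apply: in_Zp_pM.
Qed.

Lemma qpoch_neq0 (q b : Omega) d : abs (q - 1) < 1 -> (forall N, q ^+ (p ^ N) != 1) ->
  in_Zp b -> (forall i : nat, b + i%:R != 0) -> qpoch (qpow q b) q d != 0.
Proof.
move=> q1 qN hb b0; apply/prodf_neq0 => i _; rewrite subr_eq0 eq_sym.
rewrite -(qpow_nat p_prime) -(qpowD p_prime) //; last exact: in_Zp_nat.
apply/negP => /eqP/(qpow_eq1 p_prime q1 qN) h; move/negP: (b0 i); apply; apply/eqP; apply: h.
by apply: (in_ZpD p_prime) => //; apply: in_Zp_nat.
Qed.

(** The denominators could vanish only if p(a_j - a_k) were an integer, which the perturbation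
    excludes for distinct j and k; for j = k the exponents are positive integers. *)
Lemma generic_dense n h (a : 'I_n -> Omega) q (d : R) : admissible h a q -> 0 < d ->
  exists a' q', [/\ generic h a' q', forall i, abs (a' i - a i) < d & abs (q' - q) < d].
Proof.
case=> hh ha hq d0.
have [q' [qq' hq' qN]] := non_root_dense hq d0.
have [a' [ha' aa' aN]] := non_int_dense ha d0.
have q1 : abs (q' - 1) < 1 by case/andP: hq'.
have adm : admissible h a' q' by split.
have Z1 : in_Zp (1 : Omega) := in_Zp_nat p_prime Omega 1.
exists a', q'; split=> //; split=> //.
- move=> j k d'; apply: qpoch_neq0 => // [|i].
    by apply: (in_ZpD p_prime) => //; apply: (in_ZpB p_prime); apply: in_Zp_pM.
  rewrite /scale_p -mulrBr -addrA -[1]/(1%:R) -natrD.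
  have [->|jk] := eqVneq j k.
    by rewrite subrr mulr0 add0r natr_Omega_neq0.
  rewrite addr_eq0; have := aN j k (- (1 + i)%N%:Z) jk.
  by rewrite rmorphN /= -pmulrn.
- move=> j k d'; apply: qpoch_neq0 => // [|N||i].
  + exact: (qX_lt1 p_prime).
  + by rewrite -exprM -expnS.
  + by apply: (in_ZpD p_prime) => //; apply: (in_ZpB p_prime).
  rewrite -addrA -[1]/(1%:R) -natrD.
  have [->|jk] := eqVneq j k.
    by rewrite subrr add0r natr_Omega_neq0.
  apply/negP => /eqP E; have := aN j k (- (p * (1 + i))%N%:Z) jk.
  rewrite rmorphN /= -pmulrn -addr_eq0 natrM -mulrDr E mulr0 eqxx //.
rewrite (Psi'_frob0 p_prime adm); apply: vander_unit => // i j ij.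
exact: (aN i j 0 ij).
Qed.

End GenericDensity.

(** * Limits from generic parameters *)

Section GenericLimit.
Variables (R : realType) (p : nat).
Hypothesis p_prime : prime p.
Variable Omega : completedAlgClosureQp R p.
Variable n : nat.
Local Notation abs := (@pabs R p Omega).
Local Notation cvg := (cvg_seq_to abs).
Local Notation pinv := (p%:R^-1 : R).
Local Notation mxA := (mx_alg Omega n).
Implicit Types (h q : Omega) (a : 'I_n.+1 -> Omega).

(** The rate [theta_of q] is |p| or |q - 1|, itself an absolute value, so w can be (q - 1) p or (q -
    1)^2. *)
Lemma scaling_exists q : exists w : Omega, abs w = abs (q - 1) * theta_of q.
Proof.
rewrite /theta_of; case: leP => _; first by exists ((q - 1) * p%:R); rewrite pabsM pabs_p.
by exists ((q - 1) * (q - 1)); rewrite pabsM.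
Qed.

(** [M] is the limit, as natural m tends to h, of the model [S] written in the original basis. The
    eigenvector equations pass to the limit, and at generic parameters the constant term stays close
    to [S]. *)
Lemma generic_limit_exists h a q : admissible h a q ->
  exists M : 'M[Omega]_n.+1, is_generic_limit h a q 0 M /\
    forall i, M *m fixed_pt a q i = U0_eigenvalue h a q i *: fixed_pt a q i.
Proof.
move=> adm; have [hh ha /andP[tau0 q1]] := adm.
have [w absw] := scaling_exists q.
pose theta := theta_of q; pose tau := abs (q - 1).
have t_ge : pinv <= theta := theta_of_ge q.
have t_lt1 : theta < 1 := theta_of_lt1 p_prime q1.
have t_ge0 : 0 <= theta := theta_ge0 p_prime t_ge.
have tau_t : tau <= theta := theta_of_q q.
have absw' : abs w = tau * theta by [].
have w0 : 0 < abs w.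
  by rewrite absw' mulr_gt0 //; apply: lt_le_trans (pinv_gt0 R p_prime) t_ge.
have wtau : abs w <= tau by rewrite absw' ler_piMr ?ltW.
have [K1 K10 hT] := mx_bd_exists (unscale_mx n w).
have [K2 K20 hS] := mx_bd_exists (scale_mx n w).
(* [K] is the cost of conjugating by the change of basis. *)
pose K := K1 * K2; have K0 : 0 < K by rewrite mulr_gt0.
pose S q x m : mxA := unscale_mx n w * model_mx w q x m * scale_mx n w.
have bdS r (A B : mxA) : bd r (A - B) -> bd (K * r) (unscale_mx n w * A * scale_mx n w - unscale_mx n w * B * scale_mx n w).
  move=> h0; rewrite -mulrBl -mulrBr /K mulrAC; apply: bdM => //; exact: bdM.
have nn q' a' : (forall j, in_Zp (a' j)) -> abs (q' - 1) = tau -> near_one w (node a' q').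
  by move=> ha' hq'; apply: (near_node p_prime t_ge t_lt1 tau0 tau_t absw').
have [u hu] := Zp_seq p_prime hh.
have ucong k l : (k <= l)%N -> u l = u k %[mod p ^ k]%N.
  move=> kl; apply/eqP; rewrite -(abs_natB_le_exp p_prime Omega).
  apply: (@abs_tri_le _ _ _ _ h) => //; rewrite absBC; apply: le_trans (hu l) _.
  by rewrite ler_wiXn2l // ltW ?pinv_gt0 ?pinv_lt1.
have Scong k l i j : (k <= l)%N ->
    abs ((S q (node a q) (u l) : 'M_n.+1) i j - (S q (node a q) (u k) : 'M_n.+1) i j) <= K * theta ^+ k.
  move=> kl.
  have := bdS _ _ _ (model_mx_cong p_prime t_ge t_lt1 tau0 tau_t absw' (nn q a ha erefl) erefl (ucong k l kl)).
  by move=> /(_ i j); rewrite !mxE.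
have small e : 0 < e -> exists N, forall k, (N <= k)%N -> K * theta ^+ k < e.
  by move=> e0; apply: cexpr_lt_eps; rewrite ?(ltW K0) ?t_ge0.
pose M : 'M[Omega]_n.+1 := \matrix_(i, j) lim_seq (fun k => (S q (node a q) (u k) : 'M_n.+1) i j).
have MP i j : cvg (fun k => (S q (node a q) (u k) : 'M_n.+1) i j) (M i j) /\
    forall k, abs (M i j - (S q (node a q) (u k) : 'M_n.+1) i j) <= K * theta ^+ k.
  have [x cx hx] := cauchy_rate small (fun k l => @Scong k l i j).
  by rewrite mxE (lim_seqE cx).
have TY q' a' : abs (q' - 1) = tau -> unscale_mx n w *m vander (rescale w (node a' q')) = vander (node a' q').
  by move=> hq'; apply: mul_vander => j; apply: (unscale_mx_powers p_prime t_ge t_lt1 tau0 tau_t absw').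
have SX q' a' : abs (q' - 1) = tau -> scale_mx n w *m vander (node a' q') = vander (rescale w (node a' q')).
  by move=> hq'; apply: mul_vander => j; apply: (scale_mx_powers p_prime t_ge t_lt1 tau0 tau_t absw').
exists M; split=> [e e0|i]; last first.
  rewrite (fixed_ptE p_prime i adm) col_vander; set v := powers n _.
  have Sv m : (S q (node a q) m : 'M_n.+1) *m v = U0_eigenvalue m%:R a q i *: v.
    have mulA (A B C : 'M[Omega]_n.+1) : A * B * C *m v = A *m (B *m (C *m v)).
      by rewrite !mulmxA.
    rewrite mulA (scale_mx_powers p_prime t_ge t_lt1 tau0 tau_t absw').
    rewrite (model_mx_eigen p_prime t_ge t_lt1 tau0 tau_t absw' i ha erefl (nn q a ha erefl) (erefl m%:R)).
    by rewrite -scalemxAr (unscale_mx_powers p_prime t_ge t_lt1 tau0 tau_t absw').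
  apply/colP => k; apply: (@cvg_unique _ _ _ (fun l => ((S q (node a q) (u l) : 'M_n.+1) *m v) k 0)).
    rewrite mxE; apply: cvg_ext (cvg_sum _ _) => [l|j _]; first by rewrite mxE.
    exact: (cvgM (MP k j).1 (cvg_cst (v j 0))).
  rewrite mxE; apply: cvg_ext (cvgM (u := fun l => U0_eigenvalue (u l)%:R a q i) _ (cvg_cst (v k 0))) => [l|]; first by rewrite Sv [RHS]mxE.
  apply: (cvg_eigenvalue p_prime t_lt1 tau0 tau_t i ha erefl hh) => [l|]; first exact: in_Zp_nat.
  exact: (cvg_rate p_prime).
have [k hk] := small e e0.
pose rho := e / (K * 2).
have rho0 : 0 < rho by rewrite divr_gt0 // mulr_gt0.
have Krho : K * rho < e.
  have -> : K * rho = e / 2 by rewrite /rho; field; rewrite gt_eqF.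
  by rewrite ltr_pdivrMr // ltr_pMr // ltr1n.
have [N hN] : exists N, forall k, (N <= k)%N -> tau * theta ^+ k < rho * abs w.
  by apply: cexpr_lt_eps; [exact: ltW | rewrite t_ge0 | exact: mulr_gt0].
(* The four radii make h' close to [u k], move the nodes little through a and through q, and force
   |q' - 1| = [tau], as the model requires. *)
exists (Num.min (Num.min (pinv ^+ k) (pinv ^+ N)) (Num.min (rho * abs w) tau)).
  by rewrite !lt_min !exprn_gt0 ?(pinv_gt0 R p_prime) //= mulr_gt0.
move=> h' a' q' [adm' _ _ uV']; rewrite (Psi'_frob0 p_prime adm') in uV'.
have [hh' ha' /andP[_ q1']] := adm'.
rewrite !lt_min => /andP[/andP[dh _] _] da /andP[_ /andP[dq dq']].
have hq' : abs (q' - 1) = tau by apply: abs_near; rewrite opprB addrA subrK.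
have dnode j : abs (node a q j - node a' q' j) <= rho * abs w.
  have paj : in_Zp (p%:R * a j) by apply: in_Zp_pM.
  have paj' : in_Zp (p%:R * a' j) by apply: in_Zp_pM.
  apply: (@abs_tri_le _ _ _ _ (qpow q (p%:R * a' j))).
    apply: le_trans (ltW (hN N (leqnn N))).
    apply: (qpow_lip p_prime t_ge t_lt1 tau_t) => //; rewrite -mulrBr pabsM.
    have := da j; rewrite !lt_min absBC => /andP[/andP[_ /ltW daj] _].
    by apply: le_trans daj; rewrite ler_piMl ?pabs_ge0 ?abs_nat_le1.
  by apply: le_trans (qpow_lip_base p_prime q1 q1' paj') _; rewrite absBC ltW.
have dqt : abs (q - q') <= rho * tau.
  by rewrite absBC; apply: le_trans (ltW dq) _; rewrite ler_wpM2l // ltW.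
have hm : abs (h' - (u k)%:R) <= pinv ^+ k by apply: abs_tri_le (ltW dh) (hu k).
(* [unscale_mx] takes Y to V and [scale_mx] takes V to Y, which rewrites V D V^-1 as the conjugate
   of Y D Y^-1. *)
have UE : U_generic h' a' q' 0 = unscale_mx n w * (vander (rescale w (node a' q')) *m eig_mx h' a' q'
    *m invmx (vander (rescale w (node a' q')))) * scale_mx n w.
  rewrite (U_generic0 p_prime adm'); set V := vander _; set Y := vander _.
  have VE : unscale_mx n w *m Y = V := TY _ _ hq'.
  have YE : scale_mx n w *m V = Y := SX _ _ hq'.
  have uY : Y \in unitmx by move: uV'; rewrite -/V -VE unitmx_mul => /andP[].
  have -> : invmx V = invmx Y *m scale_mx n w.
    by rewrite -[RHS](mulmxK uV') -!mulmxA [_ *m (V *m _)]mulmxA YE mulmxA mulVmx ?mul1mx.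
  have mulE (A B C : 'M[Omega]_n.+1) : A * B * C = A *m B *m C by [].
  by rewrite mulE -{1}VE !mulmxA.
(* The path goes from the constant term to the model at the generic point, then to the model at a
   and q, then to its limit [M]. *)
move=> i j; apply: (@abs_tri_lt _ _ _ _ ((S q' (node a' q') (u k) : 'M_n.+1) i j)).
  apply: le_lt_trans (hk k (leqnn k)).
  have := bdS _ _ _ (generic_model p_prime t_ge t_lt1 tau0 tau_t absw' ha' hh' hq' uV' hm).
  by rewrite UE => /(_ i j); rewrite mxE [X in _ + X]mxE.
apply: (@abs_tri_lt _ _ _ _ ((S q (node a q) (u k) : 'M_n.+1) i j)); last first.
  by rewrite absBC; apply: le_lt_trans (hk k (leqnn k)); have [_] := MP i j.
rewrite absBC; apply: le_lt_trans Krho.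
have := bdS _ _ _ (model_mx_lip p_prime t_ge t_lt1 tau0 tau_t absw' (u k) (ltW rho0)
  (nn q a ha erefl) (nn q' a' ha' hq') erefl hq' dqt dnode).
by move=> /(_ i j); rewrite mxE [X in _ + X]mxE.
Qed.

(** By [generic_dense] some generic parameters lie within both radii, and there both limits are
    approximated by the same matrix. *)
Lemma generic_limit_unique h a q m (M M' : 'M[Omega]_n.+1) : admissible h a q ->
  is_generic_limit h a q m M -> is_generic_limit h a q m M' -> M = M'.
Proof.
move=> adm hM hM'; apply/matrixP => i j; apply/eqP; rewrite -subr_eq0; apply/eqP/small_abs_eq0 => e e0.
have [[d d0 hd] [d' d0' hd']] := (hM e e0, hM' e e0).
have dd0 : 0 < Num.min d d' by rewrite lt_min d0.
have [a' [q' [gen da dq]]] := generic_dense p_prime adm dd0.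
have lt_d x : x < Num.min d d' -> x < d by rewrite lt_min => /andP[].
have lt_d' x : x < Num.min d d' -> x < d' by rewrite lt_min => /andP[].
apply: ltW; apply: (@abs_tri_lt _ _ _ _ (U_generic h a' q' m i j)).
  rewrite absBC; apply: hd => // [|k|]; rewrite ?subrr ?abs0 //; first exact: lt_d.
  exact: lt_d.
apply: hd' => // [|k|]; rewrite ?subrr ?abs0 //; first exact: lt_d'.
exact: lt_d'.
Qed.

End GenericLimit.

Theorem corollary5p4 (R : realType) (p : nat) (p_prime : prime p)
    (Omega : completedAlgClosureQp R p) (n : nat) (n_ge1 : (1 <= n)%N)
    (h : Omega) (a : 'I_n -> Omega) (q : Omega)
    (hZp : in_Zp h) (aZp : forall i : 'I_n, in_Zp (a i))
    (hq : 0 < pabs (q - 1) < 1)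
    (a_distinct : injective a) :
  forall i : 'I_n,
    frobU h a q 0%N *m fixed_pt a q i = U0_eigenvalue h a q i *: fixed_pt a q i.
Proof.
(* The size becomes a successor, as the ring of matrices requires. *)
case: n n_ge1 a aZp a_distinct => // n _ a aZp _ i.
have adm : admissible h a q by [].
(* At generic parameters the constant term is V D V^-1 itself; elsewhere it is the limit from
   generic values. *)
rewrite /frobU; case: asboolP => [[_ _ _ uV]|_].
  by apply: U_generic0_eigen; rewrite // -(Psi'_frob0 p_prime adm).
have [M [limM eigM]] := generic_limit_exists p_prime adm.
(* [M] rules out the default value of [xget], and uniqueness identifies the selected limit with
   [M]. *)
case: xgetP => [M' _ limM'|/(_ M)//].
by rewrite -(generic_limit_unique p_prime adm limM limM') eigM.
Qed.
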